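(* Fix $n\in\mathbb{N}$. If $\mathcal{X}$ is a computable linear ordering and $\boldsymbol\omega^{n}(\mathcal{X})$ has a computable descending sequence, then $0^{(n)}$ computes a descending sequence in $\mathcal{X}$. Conversely, there exists a computable linear ordering $\mathcal{X}$ with a computable descending sequence in $\boldsymbol\omega^{n}(\mathcal{X})$ such that the Turing jump of every descending sequence in $\mathcal{X}$ computes $0^{(n)}$.
   Context: A descending sequence in a linear ordering is an infinite strictly decreasing sequence of its elements. For a linear ordering $\mathcal{X}$, the linear ordering $\boldsymbol\omega^{\mathcal{X}}$ has as elements the finite strings $\langle x_0,\dots,x_{k-1}\rangle$ of elements of $\mathcal{X}$ (including the empty string) with $x_0\geq_{\mathcal{X}} x_1\geq_{\mathcal{X}}\dots\geq_{\mathcal{X}} x_{k-1}$ (thought of as $\omega^{x_0}+\dots+\omega^{x_{k-1}}$), ordered by: $\langle x_0,\dots,x_{k-1}\rangle\leq\langle y_0,\dots,y_{l-1}\rangle$ iff either $k\leq l$ and $x_i=y_i$ for all $i<k$, or at the least $i$ with $x_i\neq y_i$ we have $x_i<_{\mathcal{X}} y_i$. Iterates: $\boldsymbol\omega^{0}(\mathcal{X})=\mathcal{X}$ and $\boldsymbol\omega^{n+1}(\mathcal{X})=\boldsymbol\omega^{\boldsymbol\omega^{n}(\mathcal{X})}$. $0^{(n)}$ denotes the $n$-th Turing jump of the empty set. *)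

(* Defs.v *)
From HB Require Import structures.
From mathcomp Require Import all_boot.
Set Implicit Arguments. Unset Strict Implicit. Unset Printing Implicit Defensive.

Definition npair (x y : nat) : nat := (2 ^ x * (2 * y).+1).-1.
Definition nfst (n : nat) : nat := logn 2 n.+1.
Definition nsnd (n : nat) : nat := (n.+1 %/ 2 ^ nfst n).-1./2.

Inductive code : Type :=
| cZero | cSucc | cId | cFst | cSnd | cOracle
| cComp of code & code
| cPair of code & code
| cRec  of code & code
| cMu   of code.

Inductive eval (A : nat -> Prop) : code -> nat -> nat -> Prop :=
| ev_zero x : eval A cZero x 0
| ev_succ x : eval A cSucc x x.+1
| ev_id x : eval A cId x x
| ev_fst x : eval A cFst x (nfst x)
| ev_snd x : eval A cSnd x (nsnd x)
| ev_orc1 x : A x -> eval A cOracle x 1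
| ev_orc0 x : ~ A x -> eval A cOracle x 0
| ev_comp f g x y z : eval A g x y -> eval A f y z -> eval A (cComp f g) x z
| ev_pair f g x y1 y2 : eval A f x y1 -> eval A g x y2 ->
    eval A (cPair f g) x (npair y1 y2)
| ev_rec0 f g y z : eval A f y z -> eval A (cRec f g) (npair 0 y) z
| ev_recS f g m y w z : eval A (cRec f g) (npair m y) w ->
    eval A g (npair m (npair w y)) z -> eval A (cRec f g) (npair m.+1 y) z
| ev_mu f x m : eval A f (npair m x) 0 ->
    (forall k, k < m -> exists2 v, v <> 0 & eval A f (npair k x) v) ->
    eval A (cMu f) x m.

(* Effective Goedel numbering of codes (via mathcomp's countType encoding). *)
Fixpoint enc_code (c : code) : GenTree.tree nat :=
  match c with
  | cZero => GenTree.Node 0 [::]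
  | cSucc => GenTree.Node 1 [::]
  | cId => GenTree.Node 2 [::]
  | cFst => GenTree.Node 3 [::]
  | cSnd => GenTree.Node 4 [::]
  | cOracle => GenTree.Node 5 [::]
  | cComp f g => GenTree.Node 6 [:: enc_code f; enc_code g]
  | cPair f g => GenTree.Node 7 [:: enc_code f; enc_code g]
  | cRec f g => GenTree.Node 8 [:: enc_code f; enc_code g]
  | cMu f => GenTree.Node 9 [:: enc_code f]
  end.

Fixpoint dec_code (t : GenTree.tree nat) : option code :=
  match t with
  | GenTree.Node 0 [::] => Some cZero
  | GenTree.Node 1 [::] => Some cSucc
  | GenTree.Node 2 [::] => Some cId
  | GenTree.Node 3 [::] => Some cFst
  | GenTree.Node 4 [::] => Some cSnd
  | GenTree.Node 5 [::] => Some cOracle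
  | GenTree.Node 6 [:: a; b] =>
      obind (fun f => omap (cComp f) (dec_code b)) (dec_code a)
  | GenTree.Node 7 [:: a; b] =>
      obind (fun f => omap (cPair f) (dec_code b)) (dec_code a)
  | GenTree.Node 8 [:: a; b] =>
      obind (fun f => omap (cRec f) (dec_code b)) (dec_code a)
  | GenTree.Node 9 [:: a] => omap cMu (dec_code a)
  | _ => None
  end.

Lemma enc_codeK : pcancel enc_code dec_code.
Proof. by elim=> //= f -> // g ->. Qed.

HB.instance Definition _ := Countable.copy code (pcan_type enc_codeK).

Definition emptyset : nat -> Prop := fun _ => False.

Definition computes_fun (A : nat -> Prop) (f : nat -> nat) : Prop :=
  exists c : code, forall x, eval A c x (f x).

Definition computes_set (A B : nat -> Prop) : Prop :=
  exists c : code, forall x, (B x -> eval A c x 1) /\ (~ B x -> eval A c x 0).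

Definition computable_fun (f : nat -> nat) := computes_fun emptyset f.
Definition computable_set (B : nat -> Prop) := computes_set emptyset B.
Definition computable_rel (R : nat -> nat -> Prop) :=
  computable_set (fun p => R (nfst p) (nsnd p)).

Definition jump (A : nat -> Prop) : nat -> Prop :=
  fun e => match unpickle e with
           | Some c => exists y, eval A c e y
           | None => False
           end.

Definition jumpn (n : nat) (A : nat -> Prop) := iter n jump A.

(* a function as an oracle: its graph *)
Definition graph (f : nat -> nat) : nat -> Prop := fun p => f (nfst p) = nsnd p.

Record LO := MkLO { ldom : nat -> Prop; lle : nat -> nat -> Prop }.

Definition is_linear_order (X : LO) : Prop :=
  [/\ (forall x, ldom X x -> lle X x x),
      (forall x y, ldom X x -> ldom X y -> lle X x y -> lle X y x -> x = y),
      (forall x y z, ldom X x -> ldom X y -> ldom X z ->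
          lle X x y -> lle X y z -> lle X x z) &
      (forall x y, ldom X x -> ldom X y -> lle X x y \/ lle X y x)].

Definition computable_LO (X : LO) : Prop :=
  computable_set (ldom X) /\ computable_rel (lle X).

Definition llt (X : LO) (x y : nat) : Prop := lle X x y /\ x <> y.

Definition descending (X : LO) (f : nat -> nat) : Prop :=
  forall i, ldom X (f i) /\ llt X (f i.+1) (f i).

(* Finite strings are coded by the bijection CodeSeq.decode : nat -> seq nat. *)
Definition str_le (X : LO) (s t : seq nat) : Prop :=
  (size s <= size t /\ forall i, i < size s -> nth 0 s i = nth 0 t i)
  \/ (exists i, [/\ i < size s, i < size t,
                   (forall j, j < i -> nth 0 s j = nth 0 t j) &
                   llt X (nth 0 s i) (nth 0 t i)]).

Definition omega_pow (X : LO) : LO :=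
  MkLO (fun n => let s := CodeSeq.decode n in
                 (forall i, i < size s -> ldom X (nth 0 s i)) /\
                 (forall i, i.+1 < size s -> lle X (nth 0 s i.+1) (nth 0 s i)))
       (fun n m => str_le X (CodeSeq.decode n) (CodeSeq.decode m)).

Definition omega_iter (n : nat) (X : LO) : LO := iter n omega_pow X.

(* Main.v *)
Require Import Defs.
From mathcomp Require Import all_boot.
From mathcomp Require Import boolp.
(* PART 1. Let s_0 > s_1 > ... descend in omega^X.  Call (k, i) settled when the
   first k letters of s_j agree for all j >= i.  From every settled pair one
   reaches another settled pair whose letter is smaller in X, and being settled
   is co-r.e. in the sequence; so one jump of the sequence computes a descending
   sequence in X, and n exponentials cost n jumps.

   PART 2 uses iterated true stages.  Starting from R_0 = (nat, <=), the tree
   order R_{n+1} on nat refines R_n: s lies below t when no stage of the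
   R_n-branch of t after s enumerates a smaller number into the jump of the
   oracle read off the R_n-branch.  The true stages P_n form the only infinite
   path of R_n, and P_{n+1} computes the jump of P_n, so P_n computes 0^(n).
   X_n is the Kleene-Brouwer order of R_n.  Mapping x to the string of its
   R_n-predecessors followed by a second x embeds X_n into omega^X_{n+1};
   composing, the descending sequence 0 > 1 > 2 > ... of X_0 becomes a computable
   descending sequence of omega^n(X_n).  Every descending sequence g of X_n
   converges to the path P_n, which is therefore computable from the jump of g. *)
Set Implicit Arguments. Unset Strict Implicit. Unset Printing Implicit Defensive.

(** * Functions computable from an oracle *)

(** The second copy of the last letter reconciles two opposite conventions: a Kleene-Brouwer order
    puts a node above its extensions, the exponential puts a string below its extensions. With the
    copy, the strings of y and of an extension of y through r differ at the letters y and r. Two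
    demands on X_{n+1} result. An R_n-extension of a stage must lie below it, even if R_{n+1} no
    longer relates the two; and R_n-siblings must keep their order. For the latter, priorities are
    read off the parent, so that R_n-siblings remain siblings in R_{n+1}. Together the demands lead
    to an order on siblings that is again of Kleene-Brouwer type, not the order of numbers. As a
    node may have infinitely many children, well-foundedness among siblings has to be carried
    through the induction; it survives because P_n contains only finitely many stages with a given
    R_{n+1}-parent. The jump is defined on pickled indices, while the stages need bounded halting
    tests computable uniformly in the oracle; hence the computable decoder of indices and the normal
    form. *)

Lemma npairS x y : (npair x y).+1 = 2 ^ x * (2 * y).+1.
Proof. by rewrite /npair prednK // muln_gt0 expn_gt0. Qed.

Lemma nfst_npair x y : nfst (npair x y) = x.
Proof.
rewrite /nfst npairS lognM ?expn_gt0 // pfactorK //.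
by rewrite logn_coprime ?addn0 // coprime2n /= oddM.
Qed.

Lemma nsnd_npair x y : nsnd (npair x y) = y.
Proof.
by rewrite /nsnd nfst_npair npairS mulKn ?expn_gt0 //= mul2n doubleK.
Qed.

Definition npairE := (nfst_npair, nsnd_npair).

Lemma npair_eta p : npair (nfst p) (nsnd p) = p.
Proof.
apply: succn_inj; rewrite npairS /nsnd.
have [m] := @pfactor_coprime 2 p.+1 isT isT.
rewrite -/(nfst p) coprime2n => oddm E.
have -> : p.+1 %/ 2 ^ nfst p = m by rewrite {1}E mulnK ?expn_gt0.
by case: m oddm E => //= m /negbTE oddm E; rewrite mul2n halfK oddm subn0 mulnC -E.
Qed.

Lemma npair_inj x y x' y' : npair x y = npair x' y' -> x = x' /\ y = y'.
Proof.
by move=> E; move: (congr1 nfst E) (congr1 nsnd E); rewrite !npairE.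
Qed.

Lemma leq_npairl x y : x <= npair x y.
Proof.
rewrite -ltnS npairS; apply: leq_trans (ltn_expl x (isT : 1 < 2)) _.
by rewrite -{1}[2 ^ x]muln1 leq_mul2l orbT.
Qed.

Lemma leq_npairr x y : y <= npair x y.
Proof.
rewrite -ltnS npairS -[y.+1]mul1n leq_mul ?expn_gt0 //.
by rewrite ltnS mul2n -addnn leq_addr.
Qed.

Arguments npair : simpl never.
Arguments nfst : simpl never.
Arguments nsnd : simpl never.

Lemma eval_compE A f g x z : eval A (cComp f g) x z ->
  exists2 y, eval A g x y & eval A f y z.
Proof. by move=> E; inversion E; subst; eexists; eauto. Qed.

Lemma eval_pairE A f g x z : eval A (cPair f g) x z ->
  eval A f x (nfst z) /\ eval A g x (nsnd z).
Proof. by move=> E; inversion E; subst; rewrite !npairE. Qed.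

Lemma eval_rec0E A f g y z : eval A (cRec f g) (npair 0 y) z -> eval A f y z.
Proof.
by move=> E; inversion E; subst;
  match goal with H : npair _ _ = npair _ _ |- _ => case: (npair_inj H) => // _ <- end.
Qed.

Lemma eval_recSE A f g m y z : eval A (cRec f g) (npair m.+1 y) z ->
  exists2 w, eval A (cRec f g) (npair m y) w & eval A g (npair m (npair w y)) z.
Proof.
move=> E; inversion E; subst;
  match goal with H : npair _ _ = npair _ _ |- _ => case: (npair_inj H) => // end.
by case=> <- <-; exists w.
Qed.

Lemma eval_muE A f x m : eval A (cMu f) x m -> eval A f (npair m x) 0 /\
  (forall k, k < m -> exists2 v, v <> 0 & eval A f (npair k x) v).
Proof. by move=> E; inversion E. Qed.

(** For [cMu], the smaller of two results would be a zero of the searched function by one run and a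
    nonzero by the other. *)
Lemma eval_det A c x y z : eval A c x y -> eval A c x z -> y = z.
Proof.
elim: c x y z.
- by move=> x y z E1 E2; inversion E1; inversion E2.
- by move=> x y z E1 E2; inversion E1; inversion E2.
- by move=> x y z E1 E2; inversion E1; inversion E2; subst.
- by move=> x y z E1 E2; inversion E1; inversion E2.
- by move=> x y z E1 E2; inversion E1; inversion E2.
- by move=> x y z E1 E2; inversion E1; inversion E2.
- move=> f IHf g IHg x y z /eval_compE[u Eu Ey] /eval_compE[v Ev Ez].
  by apply: IHf Ey _; rewrite (IHg _ _ _ Eu Ev).
- move=> f IHf g IHg x y z /eval_pairE[E1 E2] /eval_pairE[E3 E4].
  by rewrite -[y]npair_eta -[z]npair_eta (IHf _ _ _ E1 E3) (IHg _ _ _ E2 E4).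
- move=> f IHf g IHg x; rewrite -[x]npair_eta.
  elim: (nfst x) => [|m IHm] y z; first by move=> /eval_rec0E E1 /eval_rec0E; apply: IHf.
  move=> /eval_recSE[u Eu Ey] /eval_recSE[v Ev Ez].
  by apply: IHg Ey _; rewrite (IHm _ _ Eu Ev).
- move=> f IHf x y z /eval_muE[Ey Hy] /eval_muE[Ez Hz].
  case: (ltngtP y z) => // lt.
  + by case: (Hz _ lt) => v n0 /(IHf _ _ _ Ey) /esym.
  + by case: (Hy _ lt) => v n0 /(IHf _ _ _ Ez) /esym.
Qed.

Section Closure.
Variable A : nat -> Prop.
Implicit Types f g h : nat -> nat.

Lemma computes_ext f g : f =1 g -> computes_fun A f -> computes_fun A g.
Proof. by move=> E [c Hc]; exists c => x; rewrite -E. Qed.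

Lemma computes_id : computes_fun A (fun x => x).
Proof. by exists cId => x; constructor. Qed.

Fixpoint const_code k : code :=
  if k is k'.+1 then cComp cSucc (const_code k') else cZero.

Lemma eval_const k x : eval A (const_code k) x k.
Proof. by elim: k => [|k IH] /=; econstructor; eauto; constructor. Qed.

Lemma computes_const k : computes_fun A (fun _ => k).
Proof. by exists (const_code k) => x; apply: eval_const. Qed.

Lemma computes_comp f g :
  computes_fun A f -> computes_fun A g -> computes_fun A (fun x => f (g x)).
Proof. by move=> [c Hc] [d Hd]; exists (cComp c d) => x; econstructor; eauto. Qed.

Lemma computes_succ f : computes_fun A f -> computes_fun A (fun x => (f x).+1).
Proof. by apply: computes_comp; exists cSucc => x; constructor. Qed.

Lemma computes_nfst f : computes_fun A f -> computes_fun A (fun x => nfst (f x)).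
Proof. by apply: computes_comp; exists cFst => x; constructor. Qed.

Lemma computes_nsnd f : computes_fun A f -> computes_fun A (fun x => nsnd (f x)).
Proof. by apply: computes_comp; exists cSnd => x; constructor. Qed.

Lemma computes_npair f g : computes_fun A f -> computes_fun A g ->
  computes_fun A (fun x => npair (f x) (g x)).
Proof. by move=> [c Hc] [d Hd]; exists (cPair c d) => x; econstructor; eauto. Qed.

Lemma computes_rec (f k : nat -> nat) (g : nat -> nat -> nat -> nat) :
  computes_fun A f ->
  computes_fun A (fun p => g (nfst p) (nfst (nsnd p)) (nsnd (nsnd p))) ->
  computes_fun A k ->
  computes_fun A (fun x => nat_rect (fun _ => nat) (f x) (fun m w => g m w x) (k x)).
Proof.
move=> [c Hc] [d Hd] [e He]; exists (cComp (cRec c d) (cPair e cId)) => x.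
apply: (@ev_comp _ _ _ _ (npair (k x) x)); first by econstructor; eauto; constructor.
elim: (k x) => [|m IH] /=; first by constructor.
by econstructor; eauto; have := Hd (npair m (npair
  (nat_rect (fun _ => nat) (f x) (fun m w => g m w x) m) x)); rewrite !npairE.
Qed.

Lemma computes_mu (f h : nat -> nat) : computes_fun A f ->
  (forall x, f (npair (h x) x) = 0 /\ forall k, k < h x -> f (npair k x) <> 0) ->
  computes_fun A h.
Proof.
move=> [c Hc] Hh; exists (cMu c) => x; have [E N] := Hh x.
apply: ev_mu => [|k /N n0]; first by rewrite -[X in eval _ _ _ X]E.
by exists (f (npair k x)).
Qed.

Lemma computes2 (F : nat -> nat -> nat) f g :
  computes_fun A (fun p => F (nfst p) (nsnd p)) ->
  computes_fun A f -> computes_fun A g -> computes_fun A (fun x => F (f x) (g x)).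
Proof.
move=> HF Hf Hg; have := computes_comp HF (computes_npair Hf Hg).
by apply: computes_ext => x; rewrite !npairE.
Qed.

Lemma computes3 (F : nat -> nat -> nat -> nat) f g h :
  computes_fun A (fun p => F (nfst p) (nfst (nsnd p)) (nsnd (nsnd p))) ->
  computes_fun A f -> computes_fun A g -> computes_fun A h ->
  computes_fun A (fun x => F (f x) (g x) (h x)).
Proof.
move=> HF Hf Hg Hh.
have := computes_comp HF (computes_npair Hf (computes_npair Hg Hh)).
by apply: computes_ext => x; rewrite !npairE.
Qed.

Lemma computes_pred f : computes_fun A f -> computes_fun A (fun x => (f x).-1).
Proof.
apply: computes_comp; pose g (m w x : nat) := m.
have Hg : computes_fun A (fun p => g (nfst p) (nfst (nsnd p)) (nsnd (nsnd p))).
  by apply: computes_nfst; apply: computes_id.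
have := computes_rec (computes_const 0) Hg computes_id.
by apply: computes_ext; case.
Qed.

Lemma computes_if (b : nat -> bool) f g :
  computes_fun A (fun x => nat_of_bool (b x)) -> computes_fun A f ->
  computes_fun A g -> computes_fun A (fun x => if b x then f x else g x).
Proof.
move=> Hb Hf Hg; pose h (m w x : nat) := f x.
have Hh : computes_fun A (fun p => h (nfst p) (nfst (nsnd p)) (nsnd (nsnd p))).
  by apply: computes_comp => //; do 2 apply: computes_nsnd; apply: computes_id.
by have := computes_rec Hg Hh Hb; apply: computes_ext => x; case: (b x).
Qed.

Lemma computes_subn f g : computes_fun A f -> computes_fun A g ->
  computes_fun A (fun x => f x - g x).
Proof.
move=> Hf Hg; pose h (m w x : nat) := w.-1.
have Hh : computes_fun A (fun p => h (nfst p) (nfst (nsnd p)) (nsnd (nsnd p))).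
  by apply: computes_pred; apply: computes_nfst; apply: computes_nsnd; apply: computes_id.
have := computes_rec Hf Hh Hg; apply: computes_ext => x.
by elim: (g x) => [|k /= ->]; rewrite ?subn0 ?subnS.
Qed.

Lemma computes_eq0 f : computes_fun A f ->
  computes_fun A (fun x => nat_of_bool (f x == 0)).
Proof.
move=> Hf; have := computes_subn (computes_const 1) Hf.
by apply: computes_ext => x; case: (f x).
Qed.

Lemma computes_negb (b : nat -> bool) : computes_fun A (fun x => nat_of_bool (b x)) ->
  computes_fun A (fun x => nat_of_bool (~~ b x)).
Proof. by move=> /computes_eq0; apply: computes_ext => x; case: (b x). Qed.

Lemma computes_leq f g : computes_fun A f -> computes_fun A g ->
  computes_fun A (fun x => nat_of_bool (f x <= g x)).
Proof. by move=> Hf Hg; apply: computes_eq0; apply: computes_subn. Qed.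

Lemma computes_bif (b c d : nat -> bool) :
  computes_fun A (fun x => nat_of_bool (b x)) ->
  computes_fun A (fun x => nat_of_bool (c x)) ->
  computes_fun A (fun x => nat_of_bool (d x)) ->
  computes_fun A (fun x => nat_of_bool (if b x then c x else d x)).
Proof.
move=> Hb Hc Hd; have := computes_if Hb Hc Hd.
by apply: computes_ext => x; case: (b x).
Qed.

Lemma computes_true : computes_fun A (fun _ => nat_of_bool true).
Proof. exact: computes_const. Qed.

Lemma computes_false : computes_fun A (fun _ => nat_of_bool false).
Proof. exact: computes_const. Qed.

Lemma computes_andb (b c : nat -> bool) :
  computes_fun A (fun x => nat_of_bool (b x)) ->
  computes_fun A (fun x => nat_of_bool (c x)) ->
  computes_fun A (fun x => nat_of_bool (b x && c x)).
Proof. by move=> Hb Hc; apply: computes_bif => //; apply: computes_false. Qed.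

Lemma computes_orb (b c : nat -> bool) :
  computes_fun A (fun x => nat_of_bool (b x)) ->
  computes_fun A (fun x => nat_of_bool (c x)) ->
  computes_fun A (fun x => nat_of_bool (b x || c x)).
Proof. by move=> Hb Hc; apply: computes_bif => //; apply: computes_true. Qed.

Lemma computes_implyb (b c : nat -> bool) :
  computes_fun A (fun x => nat_of_bool (b x)) ->
  computes_fun A (fun x => nat_of_bool (c x)) ->
  computes_fun A (fun x => nat_of_bool (b x ==> c x)).
Proof. by move=> Hb Hc; apply: computes_bif => //; apply: computes_true. Qed.

Lemma computes_eqn f g : computes_fun A f -> computes_fun A g ->
  computes_fun A (fun x => nat_of_bool (f x == g x)).
Proof.
move=> Hf Hg; have := computes_andb (computes_leq Hf Hg) (computes_leq Hg Hf).
by apply: computes_ext => x; rewrite eqn_leq.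
Qed.

Lemma computes_foldr_iota (G : nat -> nat -> nat -> nat) (a b : nat -> nat) :
  computes_fun A (fun p => G (nfst p) (nfst (nsnd p)) (nsnd (nsnd p))) ->
  computes_fun A a -> computes_fun A b ->
  computes_fun A (fun x => foldr (fun i w => G i w x) (a x) (iota 0 (b x))).
Proof.
(* Recursion counts upwards while [foldr] starts from the last entry, hence the reversed index. *)
move=> HG Ha Hb; pose g (m w x : nat) := G (b x - m.+1) w x.
have Hx : computes_fun A (fun p => nsnd (nsnd p)).
  by do 2 apply: computes_nsnd; apply: computes_id.
have Hg : computes_fun A (fun p => g (nfst p) (nfst (nsnd p)) (nsnd (nsnd p))).
  apply: (computes3 HG) => //; last by apply: computes_nfst; apply: computes_nsnd; apply: computes_id.
  apply: computes_subn; first exact: computes_comp.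
  by apply: computes_succ; apply: computes_nfst; apply: computes_id.
have := computes_rec Ha Hg Hb; apply: computes_ext => x.
suff H m : m <= b x -> nat_rect (fun _ => nat) (a x) (fun m w => g m w x) m =
    foldr (fun i w => G i w x) (a x) (iota (b x - m) m).
  by have := H _ (leqnn (b x)); rewrite subnn.
by elim: m => //= m IH lt; rewrite IH ?(ltnW lt) // /g -subSn // subSS.
Qed.

Lemma computes_all (P : nat -> nat -> bool) (b : nat -> nat) :
  computes_fun A (fun p => nat_of_bool (P (nfst p) (nsnd p))) ->
  computes_fun A b ->
  computes_fun A (fun x => nat_of_bool (all (fun i => P i x) (iota 0 (b x)))).
Proof.
move=> HP Hb; pose G i w x := if P i x then w else 0.
have HG : computes_fun A (fun p => G (nfst p) (nfst (nsnd p)) (nsnd (nsnd p))).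
  apply: computes_if; last exact: computes_const.
    apply: (@computes2 P) => //; first by apply: computes_nfst; apply: computes_id.
    by do 2 apply: computes_nsnd; apply: computes_id.
  by apply: computes_nfst; apply: computes_nsnd; apply: computes_id.
have := computes_foldr_iota HG (computes_const 1) Hb; apply: computes_ext => x.
by elim: (iota _ _) => //= i s ->; rewrite /G; case: (P i x).
Qed.

Lemma computes_has (P : nat -> nat -> bool) (b : nat -> nat) :
  computes_fun A (fun p => nat_of_bool (P (nfst p) (nsnd p))) ->
  computes_fun A b ->
  computes_fun A (fun x => nat_of_bool (has (fun i => P i x) (iota 0 (b x)))).
Proof.
move=> HP Hb.
have := computes_negb (computes_all (P := fun i x => ~~ P i x) (computes_negb HP) Hb).
by apply: computes_ext => x; rewrite -has_predC; congr nat_of_bool; apply: eq_has => i /=; rewrite negbK.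
Qed.

Lemma computes_find (P : nat -> nat -> bool) (b : nat -> nat) :
  computes_fun A (fun p => nat_of_bool (P (nfst p) (nsnd p))) ->
  computes_fun A b ->
  computes_fun A (fun x => find (fun i => P i x) (iota 0 (b x))).
Proof.
move=> HP Hb; pose G i w x := if P i x then 0 else w.+1.
have HG : computes_fun A (fun p => G (nfst p) (nfst (nsnd p)) (nsnd (nsnd p))).
  apply: computes_if; [|exact: computes_const|].
    apply: (@computes2 P) => //; first by apply: computes_nfst; apply: computes_id.
    by do 2 apply: computes_nsnd; apply: computes_id.
  by apply: computes_succ; apply: computes_nfst; apply: computes_nsnd; apply: computes_id.
have := computes_foldr_iota HG (computes_const 0) Hb; apply: computes_ext => x.
by elim: (iota _ _) => //= i s ->.
Qed.

(** An existence proof without any bound makes the search total, so classically obtained witnesses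
    may be searched for. *)
Lemma computes_search (P : nat -> nat -> bool) :
  computes_fun A (fun p => nat_of_bool (P (nfst p) (nsnd p))) ->
  (forall x, exists m, P m x) ->
  exists h : nat -> nat, computes_fun A h /\ forall x, P (h x) x.
Proof.
move=> HP ex; exists (fun x => ex_minn (ex x)); split; last first.
  by move=> x; case: ex_minnP.
apply: (computes_mu (f := fun p => nat_of_bool (~~ P (nfst p) (nsnd p)))).
  exact: computes_negb.
move=> x; case: ex_minnP => m Pm min; rewrite !npairE Pm; split=> // k lt.
rewrite !npairE => E; have : P k x by case: (P k x) E.
by move/min; rewrite leqNgt lt.
Qed.

End Closure.

#[local] Hint Resolve computes_id computes_const computes_succ computes_pred
  computes_nfst computes_nsnd computes_npair computes_if computes_subn
  computes_negb computes_leq computes_bif computes_true computes_false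
  computes_andb computes_orb computes_implyb computes_eqn
  computes_all computes_has computes_find : cpt.
(** Follows the syntax of the function. Where a function variable occurs, its closure under
    substitution is first put into the context, so that it is also handled under bounded
    quantifiers. *)
Ltac cpt := auto 100 with cpt nocore.

(** * Strings coded as numbers *)

Arguments CodeSeq.decode : simpl never.
Arguments CodeSeq.code : simpl never.

(** Up to a successor, [npair] is the cons of [CodeSeq], with 0 as the empty string; codes can
    therefore take strings apart with [nfst] and [nsnd]. *)
Lemma decodeS c : CodeSeq.decode c.+1 = nfst c :: CodeSeq.decode (nsnd c).
Proof.
rewrite -(CodeSeq.decodeK (nsnd c)) -[c in LHS]npair_eta npairS CodeSeq.codeK.
by rewrite -[RHS]CodeSeq.codeK /CodeSeq.code /= -/CodeSeq.code CodeSeq.decodeK mul2n.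
Qed.

Lemma code_cons n s : CodeSeq.code (n :: s) = (npair n (CodeSeq.code s)).+1.
Proof. by rewrite npairS /CodeSeq.code /= mul2n. Qed.

Lemma decode_npair n c : CodeSeq.decode (npair n c).+1 = n :: CodeSeq.decode c.
Proof. by rewrite decodeS !npairE. Qed.

Definition dropc (i c : nat) : nat := nat_rect (fun _ => nat) c (fun _ d => nsnd d.-1) i.

Lemma decode_dropc i c : CodeSeq.decode (dropc i c) = drop i (CodeSeq.decode c).
Proof.
elim: i => [|i IH]; first by rewrite drop0.
have -> : dropc i.+1 c = nsnd (dropc i c).-1 by [].
rewrite -add1n -drop_drop -IH; case: (dropc i c) => [|d] //.
by rewrite decodeS drop1.
Qed.

Lemma nth_decode i c : nth 0 (CodeSeq.decode c) i = nfst (dropc i c).-1.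
Proof.
rewrite -[i in LHS]addn0 -nth_drop -decode_dropc nth0.
by case: (dropc i c) => [|d] //; rewrite decodeS.
Qed.

Lemma size_code s : size s <= CodeSeq.code s.
Proof.
elim: s => // n s IH; rewrite code_cons ltnS; apply: leq_trans IH _.
exact: leq_npairr.
Qed.

Lemma find_iotaE (P : pred nat) m n : n <= m -> (n < m -> P n) ->
  (forall k, k < n -> ~~ P k) -> find P (iota 0 m) = n.
Proof.
move=> le Pn min; rewrite -(subnKC le) iotaD find_cat size_iota.
have /hasPn/negbTE -> : {in iota 0 n, forall k, ~~ P k}.
  by move=> k; rewrite mem_iota => /andP[_ /min].
case E : (m - n) => [|d] /=; first by rewrite addn0.
by rewrite Pn ?addn0 // -subn_gt0 E.
Qed.

(** The code of a string bounds its length, so a bounded search finds the length. *)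
Lemma size_decode c :
  size (CodeSeq.decode c) = find (fun k => dropc k c == 0) (iota 0 c).
Proof.
have E k : (dropc k c == 0) = (size (CodeSeq.decode c) <= k).
  rewrite -subn_eq0 -size_drop -decode_dropc.
  by case: (dropc k c) => // d; rewrite decodeS.
rewrite (eq_find E); apply/esym/find_iotaE => // [|k]; last by rewrite ltnNge.
by rewrite -{2}[c]CodeSeq.decodeK size_code.
Qed.

Lemma ltn_mem_decode w t : t \in CodeSeq.decode w -> t < w.
Proof. exact: (allP (CodeSeq.gtn_decode w)). Qed.

Section Lists.
Variable A : nat -> Prop.
Implicit Types f g h c d : nat -> nat.

Lemma computes_dropc f c : computes_fun A f -> computes_fun A c ->
  computes_fun A (fun x => dropc (f x) (c x)).
Proof.
move=> Hf Hc; refine (@computes_rec A c f (fun _ w _ => nsnd w.-1) Hc _ Hf).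
by cpt.
Qed.

Lemma computes_nth c f : computes_fun A c -> computes_fun A f ->
  computes_fun A (fun x => nth 0 (CodeSeq.decode (c x)) (f x)).
Proof.
move=> Hc Hf; apply: (computes_ext (f := fun x => nfst (dropc (f x) (c x)).-1)).
  by move=> x; rewrite nth_decode.
by have := computes_dropc Hf Hc; cpt.
Qed.

Lemma computes_size c : computes_fun A c ->
  computes_fun A (fun x => size (CodeSeq.decode (c x))).
Proof.
apply: (computes_comp (f := fun x => size (CodeSeq.decode x))).
apply: (computes_ext (fun x => esym (size_decode x))).
have H := computes_dropc (computes_nfst (computes_id A)) (computes_nsnd (computes_id A)).
by cpt.
Qed.

#[local] Hint Resolve computes_nth computes_size : cpt.

Lemma decode_iota (c : nat) :
  CodeSeq.decode c = [seq nth 0 (CodeSeq.decode c) i | i <- iota 0 (size (CodeSeq.decode c))].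
Proof. exact/esym/mkseq_nth. Qed.

Lemma computes_all_decode (P : nat -> nat -> bool) c :
  computes_fun A (fun p => nat_of_bool (P (nfst p) (nsnd p))) ->
  computes_fun A c ->
  computes_fun A (fun x => nat_of_bool (all (fun t => P t x) (CodeSeq.decode (c x)))).
Proof.
move=> HP Hc; apply: (computes_ext (f := fun x => nat_of_bool (all
   (fun i => P (nth 0 (CodeSeq.decode (c x)) i) x) (iota 0 (size (CodeSeq.decode (c x))))))).
  by move=> x; rewrite [in RHS](decode_iota (c x)) all_map.
have H f g : computes_fun A f -> computes_fun A g ->
    computes_fun A (fun x => nat_of_bool (P (f x) (g x))).
  by move=> Hf Hg; apply: (computes2 (F := fun x y => nat_of_bool (P x y))).
have Hc' f : computes_fun A f -> computes_fun A (fun x => c (f x)).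
  exact: computes_comp.
by cpt.
Qed.

Lemma computes_mem c f : computes_fun A c -> computes_fun A f ->
  computes_fun A (fun x => nat_of_bool (f x \in CodeSeq.decode (c x))).
Proof.
move=> Hc Hf.
have Hf' g : computes_fun A g -> computes_fun A (fun x => f (g x)) by exact: computes_comp.
have H : computes_fun A (fun x => nat_of_bool (~~ all (fun t => t != f x) (CodeSeq.decode (c x)))).
  by apply: computes_negb; apply: (computes_all_decode (P := fun t x => t != f x)); cpt.
move: H; apply: computes_ext => x; congr nat_of_bool.
by rewrite -has_predC -has_pred1; apply: eq_has => t /=; rewrite negbK.
Qed.

Lemma computes_foldr_decode (G : nat -> nat -> nat) a c :
  computes_fun A (fun p => G (nfst p) (nsnd p)) ->
  computes_fun A a -> computes_fun A c ->
  computes_fun A (fun x => foldr G (a x) (CodeSeq.decode (c x))).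
Proof.
move=> HG Ha Hc; apply: (computes_ext (f := fun x => foldr
   (fun i w => G (nth 0 (CodeSeq.decode (c x)) i) w) (a x) (iota 0 (size (CodeSeq.decode (c x)))))).
  by move=> x; rewrite [in RHS](decode_iota (c x)) foldr_map.
have H f g : computes_fun A f -> computes_fun A g -> computes_fun A (fun x => G (f x) (g x)).
  by move=> Hf Hg; apply: (computes2 (F := fun x y => G x y)).
have Hc' f : computes_fun A f -> computes_fun A (fun x => c (f x)).
  exact: computes_comp.
apply: (computes_foldr_iota (G := fun i w x => G (nth 0 (CodeSeq.decode (c x)) i) w)); cpt.
Qed.

Lemma computes_map_decode h c : computes_fun A h -> computes_fun A c ->
  computes_fun A (fun x => CodeSeq.code (map h (CodeSeq.decode (c x)))).
Proof.
move=> Hh Hc; pose G t w := (npair (h t) w).+1.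
have HG : computes_fun A (fun p => G (nfst p) (nsnd p)).
  have Hh' f : computes_fun A f -> computes_fun A (fun x => h (f x)) by exact: computes_comp.
  by rewrite /G; cpt.
have := computes_foldr_decode HG (computes_const A 0) Hc; apply: computes_ext => x.
by elim: (CodeSeq.decode _) => // t s IH; rewrite map_cons code_cons -IH.
Qed.

(** The tail [a] makes room for the second copy of the last stage in the embedding strings. *)
Lemma computes_filter_iota (P : nat -> nat -> bool) b a :
  computes_fun A (fun p => nat_of_bool (P (nfst p) (nsnd p))) ->
  computes_fun A b -> computes_fun A a ->
  computes_fun A (fun x => CodeSeq.code
    ([seq i <- iota 0 (b x) | P i x] ++ CodeSeq.decode (a x))).
Proof.
move=> HP Hb Ha; pose G i w x := if P i x then (npair i w).+1 else w.
have HG : computes_fun A (fun p => G (nfst p) (nfst (nsnd p)) (nsnd (nsnd p))).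
  have H f g : computes_fun A f -> computes_fun A g ->
      computes_fun A (fun x => nat_of_bool (P (f x) (g x))).
    by move=> Hf Hg; apply: (computes2 (F := fun x y => nat_of_bool (P x y))).
  by rewrite /G; cpt.
have := computes_foldr_iota HG Ha Hb; apply: computes_ext => x.
elim: (iota _ _) => [|i s IH] /=; first by rewrite CodeSeq.decodeK.
by rewrite /G IH; case: (P i x) => //=; rewrite -code_cons.
Qed.

End Lists.

(** * Turing reductions and the jump *)

#[local] Hint Resolve computes_nth computes_size computes_mem : cpt.

Lemma oracle_asbool (A : nat -> Prop) : (fun x => is_true `[< A x >]) = A.
Proof. by apply/funext => x; rewrite asboolE. Qed.

Lemma computes_setE A B :
  computes_set A B <-> computes_fun A (fun x => nat_of_bool `[< B x >]).
Proof.
split=> -[c Hc]; exists c => x.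
  by have [H1 H0] := Hc x; case: asboolP => [/H1|/H0].
by have := Hc x; case: asboolP => Bx Ex; split.
Qed.

Lemma computes_oracle A : computes_fun A (fun x => nat_of_bool `[< A x >]).
Proof. by exists cOracle => x; case: asboolP => Ax; constructor. Qed.

Fixpoint oracle_subst (d c : code) : code :=
  match c with
  | cOracle => d
  | cComp f g => cComp (oracle_subst d f) (oracle_subst d g)
  | cPair f g => cPair (oracle_subst d f) (oracle_subst d g)
  | cRec f g => cRec (oracle_subst d f) (oracle_subst d g)
  | cMu f => cMu (oracle_subst d f)
  | _ => c
  end.

Lemma eval_oracle_subst A B d c x y :
  (forall z, eval B d z `[< A z >]) -> eval A c x y -> eval B (oracle_subst d c) x y.
Proof.
move=> Hd; elim: c x y => /=.
- by move=> x y E; inversion E; constructor.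
- by move=> x y E; inversion E; constructor.
- by move=> x y E; inversion E; subst; constructor.
- by move=> x y E; inversion E; constructor.
- by move=> x y E; inversion E; constructor.
- by move=> x y E; have := Hd x; inversion E; subst; case: asboolP.
- by move=> f IHf g IHg x y /eval_compE[z /IHg Eg /IHf Ef]; econstructor; eauto.
- move=> f IHf g IHg x y /eval_pairE[/IHf Ef /IHg Eg].
  by rewrite -[y]npair_eta; constructor.
- move=> f IHf g IHg x; rewrite -[x]npair_eta.
  elim: (nfst x) => [|m IHm] y; first by move=> /eval_rec0E/IHf; constructor.
  by move=> /eval_recSE[w /IHm Ew /IHg Eg]; econstructor; eauto.
- move=> f IHf x y /eval_muE[/IHf E0 Ek]; constructor=> // k /Ek[v v0 /IHf Ev].
  by exists v.
Qed.

Lemma computes_fun_trans A B f :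
  computes_set B A -> computes_fun A f -> computes_fun B f.
Proof.
move=> /computes_setE[d Hd] [c Hc]; exists (oracle_subst d c) => x.
exact: eval_oracle_subst (Hc x).
Qed.

Lemma computes_set_trans A B C :
  computes_set A B -> computes_set B C -> computes_set A C.
Proof. by move=> HB /computes_setE HC; apply/computes_setE/(computes_fun_trans HB). Qed.

(** * Indices of codes as token strings *)

Definition token_of (t : nat) : option (nat + nat) := unpickle t.

Lemma unpickle_codeE e : (unpickle e : option code) =
  obind dec_code (GenTree.decode (pmap token_of (CodeSeq.decode e))).
Proof. by []. Qed.

(** A sum is pickled as a pair of options and an option as a string of which only the head is read,
    so a token is obtained by projections. *)
Lemma token_ofE t : token_of t =
  if CodeSeq.decode t is [:: a; b] then
    if b != 0 then Some (inr (nfst b.-1))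
    else if a != 0 then Some (inl (nfst a.-1)) else None
  else None.
Proof.
rewrite -[LHS]/(obind (@sum_of_opair nat nat) (omap (@pair_of_tag _ _)
  (if CodeSeq.decode t is [:: a; b] then Some (existT (fun=> option nat)
     (ohead (pmap [eta Some] (CodeSeq.decode a))) (ohead (pmap [eta Some] (CodeSeq.decode b))))
   else None))).
case: (CodeSeq.decode t) => [|a [|b []]] //.
by case: b => [|b]; rewrite ?decodeS //; case: a => [|a]; rewrite ?decodeS.
Qed.

(* Locked, so that simplification does not compute these large unary numbers. *)
Definition token_inl n : nat := locked (pickle (inl n : nat + nat)).

Lemma token_of_inl n : token_of (token_inl n) = Some (inl n).
Proof. by rewrite /token_inl -lock; apply: pickleK. Qed.

(* An index of [cComp c (const_code x)]. GenTree.decode tolerates the omission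
   of the closing 0 tokens, so a computable prefixing suffices. *)
Definition comp_const_index (c : code) (x : nat) : nat :=
  foldr (fun t w => (npair t w).+1)
    (nat_rect (fun _ => nat) (CodeSeq.code [:: token_inl 1])
      (fun _ w => (npair (token_inl 7) (npair (token_inl 2) (npair (token_inl 0) w).+1).+1).+1) x)
    (token_inl 7 :: map pickle (GenTree.encode (enc_code c))).

Lemma foldr_gentree (T : Type) (t : GenTree.tree T) fs :
  foldr (@GenTree.decode_step T) fs (GenTree.encode t) = (t :: fs.1, fs.2).
Proof.
elim: t => //= n f IHt in fs *; elim: f IHt => //= t f IHf [].
by rewrite rcons_cat foldr_cat => -> /= /IHf[-> -> ->].
Qed.

Lemma decode_foldr_npair r s :
  CodeSeq.decode (foldr (fun t w => (npair t w).+1) r s) = s ++ CodeSeq.decode r.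
Proof. by elim: s => // t s IH; rewrite [foldr _ _ _]/= decode_npair IH. Qed.

(** Tokens are read from the right; [inl k.+1] opens a node with label [k] and [inl 0] closes one,
    so 7, 2 and 1 open [cComp], [cSucc] and [cZero]. Trailing closing tokens would only push empty
    lists, which the initial state already supplies by default. *)
Lemma comp_const_indexK c x :
  unpickle (comp_const_index c x) = Some (cComp c (const_code x)).
Proof.
rewrite unpickle_codeE /comp_const_index.
set r := nat_rect _ _ _ x.
have -> : CodeSeq.decode (foldr (fun t w => (npair t w).+1) r
    (token_inl 7 :: map pickle (GenTree.encode (enc_code c)))) =
    token_inl 7 :: map pickle (GenTree.encode (enc_code c)) ++ CodeSeq.decode r.
exact: decode_foldr_npair.
rewrite [pmap _ _]/= token_of_inl /= pmap_cat (map_pK pickleK).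
rewrite /GenTree.decode /= foldr_cat.
have -> : foldr (@GenTree.decode_step nat) ([::], [::]) (pmap token_of (CodeSeq.decode r)) =
    ([:: enc_code (const_code x)], [::]).
  rewrite /r; elim: x {r} => [|x IH].
    by rewrite CodeSeq.codeK /= token_of_inl.
  by rewrite /= !decode_npair /= !token_of_inl /= IH.
by rewrite foldr_gentree /= !enc_codeK.
Qed.

Lemma eval_const_inv A k x y : eval A (const_code k) x y -> y = k.
Proof. by move=> E; apply: eval_det E (eval_const A k x). Qed.

(** The index of a witness search for [x] is computed from [x]. Composition with a constant makes
    that code ignore its input, so the jump at its index tells whether a witness exists. *)
Lemma computes_sigma1 A (P : nat -> nat -> bool) :
  computes_fun A (fun p => nat_of_bool (P (nfst p) (nsnd p))) ->
  computes_fun (jump A) (fun x => nat_of_bool `[< exists y, P y x >]).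
Proof.
move=> HP; have [c Hc] := computes_negb HP.
have Hi : computes_fun (jump A) (comp_const_index (cMu c)).
  rewrite /comp_const_index; move: (token_inl 7 :: map _ _) => l.
  elim: l => [|t s IH]; last by simpl foldr; auto with cpt.
  simpl foldr.
  pose g (m w x : nat) :=
    (npair (token_inl 7) (npair (token_inl 2) (npair (token_inl 0) w).+1).+1).+1.
  apply: (@computes_rec _ (fun=> _) (fun x => x) g); rewrite /g; auto 20 with cpt.
have := computes_comp (computes_oracle (jump A)) Hi; apply: computes_ext => x.
congr nat_of_bool; apply: asbool_equiv_eq; rewrite /jump comp_const_indexK; split.
  move=> [y /eval_compE[z /eval_const_inv -> /eval_muE[E _]]]; exists y.
  by have := eval_det E (Hc _); rewrite !npairE; case: (P y x).
move=> ex; have [m Pm min] := ex_minnP ex; exists m.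
apply: ev_comp (eval_const _ _ _) _; apply: ev_mu.
  by have := Hc (npair m x); rewrite !npairE Pm.
move=> k lt; have := Hc (npair k x); rewrite !npairE.
by case Pk : (P k x) => E; [have := min _ Pk; rewrite leqNgt lt | exists 1].
Qed.

Lemma jump_computes A : computes_set (jump A) A.
Proof.
apply/computes_setE; have H : computes_fun A (fun p => nat_of_bool `[< A (nsnd p) >]).
  by apply: (computes_comp (computes_oracle A)); apply: computes_nsnd; apply: computes_id.
have := computes_sigma1 (P := fun _ x => `[< A x >]) H; apply: computes_ext => x.
congr nat_of_bool; apply: asbool_equiv_eq; split=> [[_ /asboolP]|Ax] //.
by exists 0; apply/asboolP.
Qed.

(** * Kleene's normal form *)

(** A second numbering, from which subcodes are obtained by projection, so that the evaluation rules
    become computable; [index_num] translates pickled indices into it. *)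
Fixpoint num (c : code) : nat :=
  match c with
  | cZero => npair 0 0
  | cSucc => npair 1 0
  | cId => npair 2 0
  | cFst => npair 3 0
  | cSnd => npair 4 0
  | cOracle => npair 5 0
  | cComp f g => npair 6 (npair (num f) (num g))
  | cPair f g => npair 7 (npair (num f) (num g))
  | cRec f g => npair 8 (npair (num f) (num g))
  | cMu f => npair 9 (num f)
  end.

(* The value [0] stands for trees that do not encode a code. *)
Definition tree_num (t : GenTree.tree nat) : nat :=
  if dec_code t is Some c then (num c).+1 else 0.

(** The effect of [dec_code] at one node, given the numbers of the children: labels up to 5 take
    none, 6 to 8 take two, 9 takes one. *)
Definition node_num (k l : nat) : nat :=
  let s := CodeSeq.decode l in
  if k <= 5 then if l == 0 then (npair k 0).+1 else 0
  else if k <= 8 then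
    if (size s == 2) && (nth 0 s 0 != 0) && (nth 0 s 1 != 0)
    then (npair k (npair (nth 0 s 0).-1 (nth 0 s 1).-1)).+1 else 0
  else if (k == 9) && (size s == 1) && (nth 0 s 0 != 0)
    then (npair 9 (nth 0 s 0).-1).+1 else 0.

Lemma tree_num_node k f :
  tree_num (GenTree.Node k f) = node_num k (CodeSeq.code (map tree_num f)).
Proof.
rewrite /node_num CodeSeq.codeK size_map.
have nz a l : (CodeSeq.code (a :: l) == 0) = false by rewrite code_cons.
rewrite /tree_num.
do 6!(case: k => [|k]; first by case: f => [|a l] //; rewrite map_cons nz).
do 3!(case: k => [|k]; first by case: f => [|a [|b [|d l]]] //=;
  case: (dec_code a) => [u|] //=; case: (dec_code b)).
case: k => [|k]; last by case: f.
by case: f => [|a [|b l]] //=; case: (dec_code a).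
Qed.

Definition state_num (fs : seq (GenTree.tree nat) * seq (seq (GenTree.tree nat))) :=
  npair (CodeSeq.code (map tree_num fs.1))
    (CodeSeq.code (map (fun l => CodeSeq.code (map tree_num l)) fs.2)).

(** [GenTree.decode_step] carried out on numbers; a token that does not parse is skipped, as [pmap]
    would drop it. *)
Definition step_num (t fs : nat) : nat :=
  let s := CodeSeq.decode t in
  let a := nth 0 s 0 in let b := nth 0 s 1 in
  if size s != 2 then fs
  else if b != 0 then npair (npair 0 (nfst fs)).+1 (nsnd fs)
  else if a == 0 then fs
  else if nfst a.-1 == 0 then npair 0 (npair (nfst fs) (nsnd fs)).+1
  else npair (npair (node_num (nfst a.-1).-1 (nfst fs)) (nfst (nsnd fs).-1)).+1
    (nsnd (nsnd fs).-1).

Lemma step_num_state t fs :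
  step_num t (state_num fs) = state_num
    (if token_of t is Some u then GenTree.decode_step u fs else fs).
Proof.
rewrite token_ofE /step_num; case: (CodeSeq.decode t) => [|a [|b []]] //=.
rewrite /state_num !npairE; case: b => [|b] /=; last by rewrite -code_cons.
case: a => [|a] //=; case: (nfst a) => [|k] /=; first by rewrite -code_cons.
rewrite -tree_num_node; case: fs => f1 [|l f2] /=; rewrite code_cons //.
by rewrite code_cons /= !npairE.
Qed.

Definition index_num (e : nat) : nat :=
  nfst (nfst (foldr step_num (npair 0 0) (CodeSeq.decode e))).-1.

Lemma index_numE e : index_num e = if unpickle e is Some c then (num c).+1 else 0.
Proof.
rewrite /index_num unpickle_codeE /GenTree.decode.
have -> : foldr step_num (npair 0 0) (CodeSeq.decode e) = state_num
    (foldr (@GenTree.decode_step nat) ([::], [::]) (pmap token_of (CodeSeq.decode e))).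
  elim: (CodeSeq.decode e) => //= t s ->; rewrite step_num_state.
  by case: (token_of t).
rewrite /state_num !npairE; case: (foldr _ _ _) => -[|t s] f2 //.
by rewrite [map _ _]/= code_cons /= npairE.
Qed.

Definition triple (u x y : nat) : nat := npair u (npair x y).

(** Intermediate values are sought below [w], which bounds all values in its members; every
    quantifier is therefore bounded, and the check is computable uniformly in the oracle. *)
Definition rule (O : nat -> bool) (w t : nat) : bool :=
  let u := nfst t in let x := nfst (nsnd t) in let y := nsnd (nsnd t) in
  let k := nfst u in let f := nfst (nsnd u) in let g := nsnd (nsnd u) in
  if k == 0 then y == 0 else if k == 1 then y == x.+1 else
  if k == 2 then y == x else if k == 3 then y == nfst x else
  if k == 4 then y == nsnd x else if k == 5 then y == O x else
  if k == 6 then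
    has (fun z => (triple g x z \in CodeSeq.decode w) && (triple f z y \in CodeSeq.decode w))
      (iota 0 w) else
  if k == 7 then
    (triple f x (nfst y) \in CodeSeq.decode w) && (triple g x (nsnd y) \in CodeSeq.decode w) else
  if k == 8 then
    if nfst x == 0 then triple f (nsnd x) y \in CodeSeq.decode w else
    has (fun z => (triple u (npair (nfst x).-1 (nsnd x)) z \in CodeSeq.decode w) &&
      (triple g (npair (nfst x).-1 (npair z (nsnd x))) y \in CodeSeq.decode w)) (iota 0 w) else
  if k == 9 then (triple (nsnd u) (npair y x) 0 \in CodeSeq.decode w) &&
    all (fun k => has (fun v => (v != 0) && (triple (nsnd u) (npair k x) v \in CodeSeq.decode w))
      (iota 0 w)) (iota 0 y)
  else false.

(* A derivation is a finite set of evaluation claims (triples), each justified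
   by a rule from other members; recursion on codes makes this well-founded. *)
Definition derivation O w := all (rule O w) (CodeSeq.decode w).

Definition kleeneT (O : nat -> bool) (e w : nat) : bool :=
  [&& index_num e != 0,
    has (fun y => triple (index_num e).-1 e y \in CodeSeq.decode w) (iota 0 w) &
    derivation O w].

Lemma derivation_sound O w c x y : derivation O w ->
  triple (num c) x y \in CodeSeq.decode w -> eval O c x y.
Proof.
move=> /allP H; elim: c x y => [||||||f IHf g IHg|f IHf g IHg|f IHf g IHg|f IHf] x y inw;
  have := H _ inw; rewrite /rule /triple [num _]/= !npairE /=.
- by move=> /eqP ->; constructor.
- by move=> /eqP ->; constructor.
- by move=> /eqP ->; constructor.
- by move=> /eqP ->; constructor.
- by move=> /eqP ->; constructor.
- by move=> /eqP ->; case E : (O x) => /=; constructor; rewrite ?E.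
- by case/hasP => z _ /andP[/IHg Eg /IHf Ef]; econstructor; eauto.
- by case/andP => /IHf Ef /IHg Eg; rewrite -[y]npair_eta; constructor.
- move=> _; rewrite -[x]npair_eta in inw *.
  elim: (nfst x) y inw => [|m IHm] y inw; have := H _ inw; rewrite /rule /triple [num _]/= !npairE /=.
    by move/IHf; constructor.
  by case/hasP => z _ /andP[/IHm Ew /IHg Eg]; econstructor; eauto.
- case/andP => /IHf E0 /allP Hk; constructor=> // k lt.
  have /hasP[v _ /andP[/eqP v0 /IHf Ev]] : has (fun v => (v != 0) &&
    (triple (num f) (npair k x) v \in CodeSeq.decode w)) (iota 0 w).
    by apply: Hk; rewrite mem_iota.
  by exists v.
Qed.

Lemma triple_ltn u x y w : triple u x y \in CodeSeq.decode w -> y < w.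
Proof.
move/ltn_mem_decode; apply: leq_ltn_trans.
by apply: leq_trans (leq_npairr _ _); exact: leq_npairr.
Qed.

Lemma rule_mono O w w' t : {subset CodeSeq.decode w <= CodeSeq.decode w'} ->
  rule O w t -> rule O w' t.
Proof.
move=> sub; rewrite /rule; do 6!(case: ifP => _; first exact: id).
have bnd u x y : triple u x y \in CodeSeq.decode w -> y \in iota 0 w'.
  by move=> /sub/triple_ltn; rewrite mem_iota.
case: ifP => _.
  by case/hasP => z _ /andP[H1 H2]; apply/hasP; exists z; rewrite ?(bnd _ _ _ H1) ?sub.
case: ifP => _; first by case/andP => /sub -> /sub ->.
case: ifP => _.
  case: ifP => _; first exact: sub.
  by case/hasP => z _ /andP[H1 H2]; apply/hasP; exists z; rewrite ?(bnd _ _ _ H1) ?sub.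
case: ifP => // _ /andP[/sub -> /allP H]; apply/allP => k /H.
by case/hasP => z _ /andP[z0 H1]; apply/hasP; exists z; rewrite ?(bnd _ _ _ H1) // z0 sub.
Qed.

Definition join w w' := CodeSeq.code (CodeSeq.decode w ++ CodeSeq.decode w').
Definition add t w := CodeSeq.code (t :: CodeSeq.decode w).

Lemma mem_join w w' t : (t \in CodeSeq.decode (join w w')) =
  (t \in CodeSeq.decode w) || (t \in CodeSeq.decode w').
Proof. by rewrite CodeSeq.codeK mem_cat. Qed.

Lemma mem_add w t u : (u \in CodeSeq.decode (add t w)) = (u == t) || (u \in CodeSeq.decode w).
Proof. by rewrite CodeSeq.codeK inE. Qed.

Lemma derivation_join O w w' :
  derivation O w -> derivation O w' -> derivation O (join w w').
Proof.
move=> /allP H /allP H'; apply/allP => t; rewrite mem_join => /orP[/H|/H'];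
  by apply: rule_mono => u; rewrite mem_join => ->; rewrite ?orbT.
Qed.

Lemma derivation_add O w t : derivation O w -> rule O w t -> derivation O (add t w).
Proof.
move=> /allP H Ht; apply/allP => u.
have sub : {subset CodeSeq.decode w <= CodeSeq.decode (add t w)}.
  by move=> v; rewrite mem_add => ->; rewrite orbT.
by rewrite mem_add => /orP[/eqP ->|/H]; apply: (rule_mono sub).
Qed.

Lemma derivation_complete (O : nat -> bool) c x y : eval O c x y ->
  exists2 w, derivation O w & triple (num c) x y \in CodeSeq.decode w.
Proof.
have leaf k a b : (forall w, rule O w (triple k a b)) ->
    exists2 w, derivation O w & triple k a b \in CodeSeq.decode w.
  move=> H; exists (add (triple k a b) 0); last by rewrite mem_add eqxx.
  exact: derivation_add.
elim: c x y => [||||||f IHf g IHg|f IHf g IHg|f IHf g IHg|f IHf] x y.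
- by move=> E; apply: leaf => w; inversion E; subst; rewrite /rule /triple [num _]/= !npairE /= ?eqxx.
- by move=> E; apply: leaf => w; inversion E; subst; rewrite /rule /triple [num _]/= !npairE /= ?eqxx.
- by move=> E; apply: leaf => w; inversion E; subst; rewrite /rule /triple [num _]/= !npairE /= ?eqxx.
- by move=> E; apply: leaf => w; inversion E; subst; rewrite /rule /triple [num _]/= !npairE /= ?eqxx.
- by move=> E; apply: leaf => w; inversion E; subst; rewrite /rule /triple [num _]/= !npairE /= ?eqxx.
- move=> E; apply: leaf => w; rewrite /rule /triple [num _]/= !npairE /=.
  by inversion E; case: (O x) H.
- case/eval_compE => z /IHg[w1 D1 M1] /IHf[w2 D2 M2].
  exists (add (triple (num (cComp f g)) x y) (join w1 w2)); last by rewrite mem_add eqxx.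
  apply: derivation_add; first exact: derivation_join.
  rewrite /rule [triple _ _ _]/triple [num _]/= !npairE /=; apply/hasP; exists z.
    by rewrite mem_iota; apply: (@triple_ltn (num g) x); rewrite mem_join M1.
  by rewrite !mem_join M1 M2 orbT.
- case/eval_pairE => /IHf[w1 D1 M1] /IHg[w2 D2 M2].
  exists (add (triple (num (cPair f g)) x y) (join w1 w2)); last by rewrite mem_add eqxx.
  apply: derivation_add; first exact: derivation_join.
  by rewrite /rule [triple _ _ y]/triple [num _]/= !npairE /= !mem_join M1 M2 orbT.
- rewrite -[x]npair_eta; elim: (nfst x) y => [|m IHm] y.
    case/eval_rec0E/IHf => w D M.
    exists (add (triple (num (cRec f g)) (npair 0 (nsnd x)) y) w); last by rewrite mem_add eqxx.
    apply: derivation_add => //.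
    by rewrite /rule [triple _ (npair 0 _) y]/triple [num _]/= !npairE.
  case/eval_recSE => z /IHm[w1 D1 M1] /IHg[w2 D2 M2].
  exists (add (triple (num (cRec f g)) (npair m.+1 (nsnd x)) y) (join w1 w2)); last by rewrite mem_add eqxx.
  apply: derivation_add; first exact: derivation_join.
  rewrite /rule [triple _ (npair m.+1 _) y]/triple [num _]/= !npairE /=; apply/hasP; exists z.
    by rewrite mem_iota; apply: (@triple_ltn (num (cRec f g)) (npair m (nsnd x))); rewrite mem_join M1.
  simpl num in M1; by rewrite !mem_join M1 M2 orbT.
- case/eval_muE => /IHf[w0 D0 M0] Hk.
  (* The derivations for the finitely many smaller arguments are joined into one. *)
  have [w1 D1 M1] : exists2 w, derivation O w & forall k, k < y ->
      exists2 v, v != 0 & triple (num f) (npair k x) v \in CodeSeq.decode w.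
    elim: y Hk {M0} => [|y IHy] Hk; first by exists 0.
    have [k lt|w1 D1 M1] := IHy; first by apply: Hk; apply: ltnW.
    have [v /eqP v0 /IHf[w2 D2 M2]] := Hk y (leqnn _).
    exists (join w1 w2); first exact: derivation_join.
    move=> k; rewrite ltnS leq_eqVlt => /orP[/eqP ->|/M1[u u0 Mu]].
      by exists v => //; rewrite mem_join M2 orbT.
    by exists u => //; rewrite mem_join Mu.
  exists (add (triple (num (cMu f)) x y) (join w0 w1)); last by rewrite mem_add eqxx.
  apply: derivation_add; first exact: derivation_join.
  rewrite /rule [triple _ x y]/triple [num _]/= !npairE /= mem_join M0 /=.
  apply/allP => k; rewrite mem_iota => /M1[v v0 Mv].
  have Mv' : triple (num f) (npair k x) v \in CodeSeq.decode (join w0 w1).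
    by rewrite mem_join Mv orbT.
  by apply/hasP; exists v; rewrite ?v0 ?Mv' // mem_iota (triple_ltn Mv').
Qed.

Lemma kleene_normal_form (O : nat -> bool) e : jump (fun x => O x) e <-> exists w, kleeneT O e w.
Proof.
rewrite /jump /kleeneT index_numE; case: (unpickle e) => [c|]; last by split => // -[].
split=> [[y /derivation_complete[w D M]]|[w /and3P[_ /hasP[y _ M] D]]].
  exists w; rewrite D andbT /=; apply/hasP; exists y => //.
  by rewrite mem_iota (triple_ltn M).
by exists y; apply: derivation_sound M.
Qed.

(** The use principle: each oracle query is part of a claim in the derivation, hence smaller than
    its code [w]. *)
Lemma kleeneT_ext O O' e w :
  (forall x, x < w -> O x = O' x) -> kleeneT O e w = kleeneT O' e w.
Proof.
move=> E; rewrite /kleeneT; have -> // : derivation O w = derivation O' w.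
apply: eq_in_all => t tw; rewrite /rule E //; apply: leq_ltn_trans (ltn_mem_decode tw).
rewrite -{2}[t]npair_eta; apply: leq_trans (leq_npairr _ _).
by rewrite -{2}[nsnd t]npair_eta; exact: leq_npairl.
Qed.

Lemma kleeneT_ltn O e w : kleeneT O e w -> e < w.
Proof.
case/and3P => _ /hasP[y _ /ltn_mem_decode]; move/(leq_ltn_trans _) => H _; apply: H.
by apply: leq_trans (leq_npairr _ _); exact: leq_npairl.
Qed.

Section ComputesKleene.
Variable A : nat -> Prop.

Lemma computes_triple f g h : computes_fun A f -> computes_fun A g -> computes_fun A h ->
  computes_fun A (fun x => triple (f x) (g x) (h x)).
Proof. by rewrite /triple; cpt. Qed.

Lemma computes_node_num f g : computes_fun A f -> computes_fun A g ->
  computes_fun A (fun x => node_num (f x) (g x)).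
Proof. by rewrite /node_num; cpt. Qed.

#[local] Hint Resolve computes_triple computes_node_num : cpt.

Lemma computes_index_num f : computes_fun A f -> computes_fun A (fun x => index_num (f x)).
Proof.
move=> Hf; have Hs : computes_fun A (fun p => step_num (nfst p) (nsnd p)).
  by rewrite /step_num; cpt.
have := computes_foldr_decode Hs (computes_const A (npair 0 0)) Hf.
by rewrite /index_num; cpt.
Qed.

#[local] Hint Resolve computes_index_num : cpt.

Lemma computes_rule (O : nat -> nat -> bool) f g h :
  computes_fun A (fun p => nat_of_bool (O (nfst p) (nsnd p))) ->
  computes_fun A f -> computes_fun A g -> computes_fun A h ->
  computes_fun A (fun x => nat_of_bool (rule (O ^~ (f x)) (g x) (h x))).
Proof.
move=> HO Hf Hg Hh.
have HO2 u v : computes_fun A u -> computes_fun A v ->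
    computes_fun A (fun x => nat_of_bool (O (u x) (v x))).
  by move=> Hu Hv; apply: (computes2 (F := fun x y => nat_of_bool (O x y))).
have Hf' u : computes_fun A u -> computes_fun A (fun x => f (u x)) by exact: computes_comp.
have Hg' u : computes_fun A u -> computes_fun A (fun x => g (u x)) by exact: computes_comp.
have Hh' u : computes_fun A u -> computes_fun A (fun x => h (u x)) by exact: computes_comp.
by rewrite /rule; cpt.
Qed.

Lemma computes_kleeneT (O : nat -> nat -> bool) f g h :
  computes_fun A (fun p => nat_of_bool (O (nfst p) (nsnd p))) ->
  computes_fun A f -> computes_fun A g -> computes_fun A h ->
  computes_fun A (fun x => nat_of_bool (kleeneT (O ^~ (f x)) (g x) (h x))).
Proof.
move=> HO Hf Hg Hh; rewrite /kleeneT /derivation.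
have Hf' u : computes_fun A u -> computes_fun A (fun x => f (u x)) by exact: computes_comp.
have Hg' u : computes_fun A u -> computes_fun A (fun x => g (u x)) by exact: computes_comp.
have Hh' u : computes_fun A u -> computes_fun A (fun x => h (u x)) by exact: computes_comp.
apply: computes_andb; first by cpt.
apply: computes_andb; first by cpt.
apply: (computes_all_decode (P := fun t x => rule (O ^~ (f x)) (h x) t)) => //.
by apply: computes_rule; cpt.
Qed.

End ComputesKleene.

(** By the normal form, the jump of [A] is existential over [B], so no indices have to be
    translated. *)
Lemma jump_mono A B : computes_set B A -> computes_set (jump B) (jump A).
Proof.
move=> /computes_setE HA; apply/computes_setE.
have HO : computes_fun B (fun p => nat_of_bool `[< A (nfst p) >]).
  by apply: (computes_comp HA); cpt.
have := @computes_kleeneT B (fun x _ => `[< A x >]) _ _ _ HO (computes_const B 0)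
  (computes_nsnd (computes_id B)) (computes_nfst (computes_id B)).
move/(computes_sigma1 (P := fun w e => kleeneT (fun x => `[< A x >]) e w)).
apply: computes_ext => e; congr nat_of_bool; apply: asbool_equiv_eq.
by rewrite -kleene_normal_form oracle_asbool.
Qed.

(** * Lexicographic orders *)

(* Lexicographic order on strings; a proper prefix is smaller than its
   extensions if [b], and larger (Kleene-Brouwer) otherwise. *)
Fixpoint lexle (b : bool) (L : rel nat) (s t : seq nat) : bool :=
  match s, t with
  | [::], [::] => true
  | [::], _ => b
  | _, [::] => ~~ b
  | x :: s', y :: t' => if x == y then lexle b L s' t' else L x y
  end.

Definition lexlt (b : bool) (L : rel nat) (s t : seq nat) : Prop :=
  (exists r u, if b then t = s ++ r :: u else s = t ++ r :: u) \/
  exists p x y u v, [/\ s = p ++ x :: u, t = p ++ y :: v, x != y & L x y].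

Lemma lexle_cat b L p s t : lexle b L (p ++ s) (p ++ t) = lexle b L s t.
Proof. by elim: p => //= x p ->; rewrite eqxx. Qed.

Lemma lexle_refl b L s : lexle b L s s.
Proof. by elim: s => //= x s ->; rewrite eqxx. Qed.

Lemma lexleP b L s t : lexle b L s t <-> s = t \/ lexlt b L s t.
Proof.
split; last first.
  case=> [->|[[r [u]]|[p [x [y [u [v [-> -> /negbTE n Lxy]]]]]]]].
  - exact: lexle_refl.
  - case: b => ->; first by rewrite -{1}[s]cats0 lexle_cat.
    by rewrite -{2}[t]cats0 lexle_cat.
  - by rewrite lexle_cat /= n.
elim: s t => [|x s IH] [|y t] /=; first by left.
- by move=> bT; right; left; exists y, t; rewrite bT.
- by move=> bF; right; left; exists x, s; rewrite (negbTE bF).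
- case: eqP => [<- /IH[->|[[r [u E]]|[p [z [w [u [v [-> -> n Lzw]]]]]]]]|/eqP n Lxy].
  + by left.
  + by right; left; exists r, u; move: E; case: (b) => ->.
  + by right; right; exists (x :: p), z, w, u, v.
  + by right; right; exists [::], x, y, s, t.
Qed.

Section LexLinear.
Variables (b : bool) (L : rel nat) (D : pred nat).
Hypothesis Lanti : {in D &, antisymmetric L}.
Hypothesis Ltrans : {in D & &, transitive L}.
Hypothesis Ltotal : {in D &, total L}.

Lemma lexle_anti s t : all D s -> all D t -> lexle b L s t -> lexle b L t s -> s = t.
Proof.
elim: s t => [|x s IH] [|y t] //=; try by case: (b).
move=> /andP[Dx Ds] /andP[Dy Dt]; rewrite [y == x]eq_sym.
case: eqP => [<- H1 H2|n Lxy Lyx]; first by rewrite (IH t).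
by case: n; apply: Lanti => //; rewrite Lxy.
Qed.

Lemma lexle_trans s t u : all D s -> all D t -> all D u ->
  lexle b L s t -> lexle b L t u -> lexle b L s u.
Proof.
elim: s t u => [|x s IH] [|y t] [|z u] //=; try by case: (b).
move=> /andP[Dx Ds] /andP[Dy Dt] /andP[Dz Du].
case: (x =P y) => [<-|nxy]; case: (x =P z) => [xz|nxz] //.
- exact: IH.
- rewrite -xz; case: (y =P x) => [yx|_ Lxy Lyx]; first by rewrite yx in nxy.
  by case: nxy; apply: Lanti => //; rewrite Lxy.
- case: (y =P z) => [<-|_ Lxy] //; exact: Ltrans Lxy.
Qed.

Lemma lexle_total s t : all D s -> all D t -> lexle b L s t || lexle b L t s.
Proof.
elim: s t => [|x s IH] [|y t] //=; try by case: (b).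
move=> /andP[Dx Ds] /andP[Dy Dt]; rewrite [y == x]eq_sym.
by case: eqP => _; [exact: IH | exact: Ltotal].
Qed.

End LexLinear.

Definition first_diff (s t : seq nat) :=
  find (fun i => ~~ [&& i < size s, i < size t & nth 0 s i == nth 0 t i]) (iota 0 (size s)).

(** Replaces recursion on two strings by a bounded search for the position where they part, a form
    in which computability is immediate. *)
Lemma lexleE b L s t : lexle b L s t =
  let i := first_diff s t in
  if i < size s then if i < size t then L (nth 0 s i) (nth 0 t i) else ~~ b
  else if i < size t then b else true.
Proof.
elim: s t => [|x s IH] [|y t] //; rewrite [lexle _ _ _ _]/= /first_diff [iota _ _]/=.
rewrite [find _ _]/=; case: eqP => [<-|n] //=.
by rewrite IH -[1]addn0 iotaDl find_map /=.
Qed.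

Lemma computes_lexle A b (L : rel nat) f g :
  computes_fun A (fun p => nat_of_bool (L (nfst p) (nsnd p))) ->
  computes_fun A f -> computes_fun A g ->
  computes_fun A (fun x => nat_of_bool
    (lexle b L (CodeSeq.decode (f x)) (CodeSeq.decode (g x)))).
Proof.
move=> HL Hf Hg; apply: (computes_ext (fun x => congr1 nat_of_bool (esym (lexleE _ _ _ _)))).
have HL2 u v : computes_fun A u -> computes_fun A v ->
    computes_fun A (fun x => nat_of_bool (L (u x) (v x))).
  by move=> Hu Hv; apply: (computes2 (F := fun x y => nat_of_bool (L x y))).
have Hf' u : computes_fun A u -> computes_fun A (fun x => f (u x)) by exact: computes_comp.
have Hg' u : computes_fun A u -> computes_fun A (fun x => g (u x)) by exact: computes_comp.
by rewrite /first_diff; case: b; cpt.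
Qed.

Definition domb (X : LO) : pred nat := fun x => `[< ldom X x >].
Definition leb (X : LO) : rel nat := fun x y => `[< lle X x y >].

Lemma str_leP X s t : str_le X s t <-> lexle true (leb X) s t.
Proof.
rewrite lexleP; split.
  case=> [[le E]|[i [lts ltt E [lexy nexy]]]].
    have Es : take (size s) t = s.
      apply: (@eq_from_nth _ 0); first by rewrite size_takel.
      by move=> i; rewrite size_takel // => lt; rewrite nth_take // E.
    case Ed : (drop (size s) t) => [|r u].
      by left; rewrite -{1}Es -[RHS](cat_take_drop (size s)) Ed cats0.
    by right; left; exists r, u; rewrite -Ed -{1}Es cat_take_drop.
  right; right; exists (take i s), (nth 0 s i), (nth 0 t i), (drop i.+1 s), (drop i.+1 t).
  split; [by rewrite -drop_nth // cat_take_drop | | exact/eqP | exact/asboolP].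
  have -> : take i s = take i t.
    apply: (@eq_from_nth _ 0); first by rewrite !size_takel // ltnW.
    by move=> j; rewrite size_takel ?(ltnW lts) // => lt; rewrite !nth_take // E.
  by rewrite -drop_nth // cat_take_drop.
case=> [->|[[r [u ->]]|[p [x [y [u [v [-> -> n /asboolP Lxy]]]]]]]]; first by left.
  left; split=> [|i lt]; first by rewrite size_cat leq_addr.
  by rewrite nth_cat lt.
right; exists (size p); rewrite !size_cat /= -!addSnnS !leq_addr; split=> //.
  by move=> j lt; rewrite !nth_cat lt.
by rewrite !nth_cat ltnn subnn /=; split=> //; apply/eqP.
Qed.

Definition nonincr (X : LO) (s : seq nat) := forall i, i.+1 < size s ->
  lle X (nth 0 s i.+1) (nth 0 s i).

Lemma ldom_omega_pow X n : ldom (omega_pow X) n <->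
  all (domb X) (CodeSeq.decode n) /\ nonincr X (CodeSeq.decode n).
Proof.
split=> -[H1 H2]; split=> //.
  by apply/(all_nthP 0) => i lt; apply/asboolP/H1.
by move=> i lt; apply/asboolP; apply: (all_nthP 0 H1).
Qed.

Lemma linear_lebP X : is_linear_order X <->
  [/\ {in domb X, reflexive (leb X)}, {in domb X &, antisymmetric (leb X)},
      {in domb X & &, transitive (leb X)} & {in domb X &, total (leb X)}].
Proof.
split=> -[R N T L]; split.
- by move=> x /asboolP Dx; apply/asboolP/R.
- by move=> x y /asboolP Dx /asboolP Dy /andP[/asboolP ? /asboolP ?]; apply: N.
- move=> y x z /asboolP Dy /asboolP Dx /asboolP Dz /asboolP ? /asboolP ?.
  by apply/asboolP; apply: T Dx Dy Dz _ _.
- move=> x y /asboolP Dx /asboolP Dy; apply/orP.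
  by case: (L x y Dx Dy) => H; [left | right]; apply/asboolP.
- by move=> x /asboolP Dx; apply/asboolP/R.
- move=> x y /asboolP Dx /asboolP Dy Lxy Lyx; apply: N => //.
  by apply/andP; split; apply/asboolP.
- move=> x y z /asboolP Dx /asboolP Dy /asboolP Dz /asboolP Lxy /asboolP Lyz.
  by apply/asboolP; apply: T Lxy Lyz.
- by move=> x y /asboolP Dx /asboolP Dy; case/orP: (L _ _ Dx Dy) => /asboolP; [left | right].
Qed.

Lemma omega_pow_linear X : is_linear_order X -> is_linear_order (omega_pow X).
Proof.
move=> /linear_lebP[R N T L]; split.
- by move=> x _; apply/str_leP/lexle_refl.
- move=> x y /ldom_omega_pow[Dx _] /ldom_omega_pow[Dy _] /str_leP Lxy /str_leP Lyx.
  by apply: (can_inj CodeSeq.decodeK); apply: (lexle_anti N Dx Dy Lxy Lyx).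
- move=> x y z /ldom_omega_pow[Dx _] /ldom_omega_pow[Dy _] /ldom_omega_pow[Dz _].
  by move=> /str_leP Lxy /str_leP Lyz; apply/str_leP; apply: (lexle_trans N T Dx Dy Dz Lxy Lyz).
- move=> x y /ldom_omega_pow[Dx _] /ldom_omega_pow[Dy _].
  by case/orP: (lexle_total true L Dx Dy) => /str_leP; [left | right].
Qed.

Definition computes_LO (A : nat -> Prop) (X : LO) :=
  computes_fun A (fun x => nat_of_bool (domb X x)) /\
  computes_fun A (fun p => nat_of_bool (leb X (nfst p) (nsnd p))).

Lemma omega_pow_computes A X : computes_LO A X -> computes_LO A (omega_pow X).
Proof.
move=> [HD HL].
have HD2 f : computes_fun A f -> computes_fun A (fun x => nat_of_bool (domb X (f x))).
  exact: (computes_comp (f := fun x => nat_of_bool (domb X x)) HD).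
have HL2 f g : computes_fun A f -> computes_fun A g ->
    computes_fun A (fun x => nat_of_bool (leb X (f x) (g x))).
  by move=> Hf Hg; apply: (computes2 (F := fun x y => nat_of_bool (leb X x y))).
split.
  apply: (computes_ext (f := fun n => nat_of_bool (all (fun i => domb X (nth 0 (CodeSeq.decode n) i))
     (iota 0 (size (CodeSeq.decode n))) && all (fun i => leb X (nth 0 (CodeSeq.decode n) i.+1)
     (nth 0 (CodeSeq.decode n) i)) (iota 0 (size (CodeSeq.decode n)).-1)))); last by cpt.
  move=> n; congr nat_of_bool; apply/andP/asboolP => /=.
    case=> /allP H1 /allP H2; split=> i lt; apply/asboolP.
      by apply: H1; rewrite mem_iota.
    by apply: H2; rewrite mem_iota; case: size lt.
  case=> H1 H2; split; apply/allP => i; rewrite mem_iota => lt; apply/asboolP.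
    exact: H1.
  by apply: H2; case: size lt.
apply: (computes_ext (f := fun p => nat_of_bool
  (lexle true (leb X) (CodeSeq.decode (nfst p)) (CodeSeq.decode (nsnd p))))).
  by move=> p; congr nat_of_bool; apply/idP/asboolP => /str_leP.
by apply: computes_lexle; cpt.
Qed.

(** * Descent in omega powers *)

(** Letter [k] has to exist in both strings, although only the letters before it are compared: it is
    the element of X extracted from a settled pair. *)
Definition agree_below (k : nat) (s t : seq nat) : bool :=
  [&& k < size s, k < size t & all (fun i => nth 0 s i == nth 0 t i) (iota 0 k)].

Lemma agree_belowP k s t : agree_below k s t <->
  exists p x y u v, [/\ size p = k, s = p ++ x :: u & t = p ++ y :: v].
Proof.
split=> [/and3P[lts ltt /allP E]|[p [x [y [u [v [<- -> ->]]]]]]]; last first.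
  rewrite /agree_below !size_cat /= -!addSnnS !leq_addr; apply/allP => i.
  by rewrite mem_iota /= add0n => lt; rewrite !nth_cat lt.
exists (take k s), (nth 0 s k), (nth 0 t k), (drop k.+1 s), (drop k.+1 t).
split; [by rewrite size_takel // ltnW | by rewrite -drop_nth // cat_take_drop |].
have -> : take k s = take k t.
  apply: (@eq_from_nth _ 0); first by rewrite !size_takel // ltnW.
  move=> i; rewrite size_takel ?(ltnW lts) // => lt; rewrite !nth_take //.
  by apply/eqP/E; rewrite mem_iota.
by rewrite -drop_nth // cat_take_drop.
Qed.

Definition strictly_desc (L : rel nat) (g : nat -> nat) : Prop :=
  forall i, L (g i.+1) (g i) && (g i.+1 != g i).

Lemma lexle_desc_lt b (L : rel nat) (D : pred nat) (s : nat -> seq nat) i j :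
  {in D &, antisymmetric L} -> {in D & &, transitive L} -> (forall i, all D (s i)) ->
  (forall i, lexle b L (s i.+1) (s i) && (s i.+1 != s i)) ->
  i < j -> lexle b L (s j) (s i) && (s j != s i).
Proof.
move=> Lanti Ltrans sD s_desc; elim: j => // j IH.
rewrite ltnS leq_eqVlt => /orP[/eqP ->|/IH /andP[L1 n1]] //.
have /andP[L2 n2] := s_desc j.
rewrite (lexle_trans Lanti Ltrans (sD _) (sD j) (sD _) L2 L1); apply/eqP => E.
by case/eqP: n1; apply: (lexle_anti Lanti (sD _) (sD _) L1); rewrite -E.
Qed.

Section DescendingLetters.
Variables (L : rel nat) (D : pred nat) (s : nat -> seq nat).
Hypothesis Lanti : {in D &, antisymmetric L}.
Hypothesis Ltrans : {in D & &, transitive L}.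
Hypothesis sD : forall i, all D (s i).
Hypothesis s_noninc : forall i k, k.+1 < size (s i) -> L (nth 0 (s i) k.+1) (nth 0 (s i) k).
Hypothesis s_desc : forall i, lexle true L (s i.+1) (s i) && (s i.+1 != s i).

Let desc_lt i j (lt : i < j) := lexle_desc_lt Lanti Ltrans sD s_desc lt.

Definition settled k i := forall j, i <= j -> agree_below k (s i) (s j).

Lemma letter_dom k i : k < size (s i) -> D (nth 0 (s i) k).
Proof. exact: (all_nthP 0 (sD i)). Qed.

Lemma settled_lt k i : settled k i -> k < size (s i).
Proof. by move=> /(_ i (leqnn i)) /and3P[]. Qed.

Lemma settled00 : settled 0 0.
Proof.
have ne i : 0 < size (s i).
  case E : (s i) => //; have := s_desc i; rewrite E.
  by case: (s i.+1).
by move=> j _; rewrite /agree_below !ne.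
Qed.

(* Either letter [k] changes later, hence drops, or it is stable and the search
   moves on to letter [k.+1] of the same string [s i]; this ends, because a string
   that is a prefix of all later ones cannot be followed by a smaller one. *)
Lemma settled_next k i : settled k i -> exists k' i',
  [/\ settled k' i', L (nth 0 (s i') k') (nth 0 (s i) k) &
      nth 0 (s i') k' != nth 0 (s i) k].
Proof.
have [d] := ubnP (size (s i) - k); elim: d k => // d IH k ltd Q.
have [[j lej nE]|stab] := pselect (exists2 j, i <= j & nth 0 (s j) k != nth 0 (s i) k).
  exists k, j; split=> //.
    move=> l lel; have /agree_belowP[p [x [y [u [v [sp Ei Ej]]]]]] := Q j lej.
    have /agree_belowP[p' [x' [z [u' [w [sp' Ei' El]]]]]] := Q l (leq_trans lej lel).
    apply/agree_belowP; exists p, y, z, v, w; split=> //.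
    by have /eqP := etrans (esym Ei) Ei'; rewrite eqseq_cat ?sp // => /andP[/eqP -> _].
  have lt : i < j by rewrite ltn_neqAle lej andbT; apply: contra nE => /eqP ->.
  have /agree_belowP[p [x [y [u [v [sp Ei Ej]]]]]] := Q j lej.
  have /andP[] := desc_lt lt; move: nE; rewrite Ei Ej lexle_cat !nth_cat sp ltnn subnn /=.
  by move=> /negbTE ->.
have stab' j : i <= j -> nth 0 (s j) k = nth 0 (s i) k.
  by move=> lej; apply/eqP/negPn/negP => nE; apply: stab; exists j.
(* A string ending with its stable letter [k] would be a prefix of its successor, hence not above
   it. *)
have long j : i <= j -> k.+1 < size (s j).
  move=> lej; have /agree_belowP[p [x [y [u [v [sp Ei Ej]]]]]] := Q j lej.
  have /agree_belowP[p' [x' [z [u' [w [sp' Ei' El]]]]]] := Q j.+1 (leqW lej).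
  have Ep : p' = p.
    by have /eqP := etrans (esym Ei') Ei; rewrite eqseq_cat ?sp // => /andP[/eqP -> _].
  have Eyz : y = z.
    have := etrans (stab' _ lej) (esym (stab' _ (leqW lej))).
    by rewrite Ej El Ep !nth_cat sp ltnn subnn.
  case: v Ej => [|b v] Ej; last by rewrite Ej size_cat sp /= !addnS !ltnS leq_addr.
  have := s_desc j; rewrite Ej El Ep Eyz lexle_cat /= eqxx.
  by case: w {El} => [|c w]; rewrite ?eqxx.
have Q' : settled k.+1 i.
  move=> j lej; have /and3P[_ _ E] := Q j lej; rewrite /agree_below !long //.
  by rewrite -[k.+1]addn1 iotaD all_cat E /= add0n (stab' _ lej) eqxx.
have lti := long i (leqnn i).
have ltd' : size (s i) - k.+1 < d.
  by rewrite -ltnS (leq_trans _ ltd) // ltnS ltn_sub2l // ltnW.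
have [k' [i' [Q2 L2 n2]]] := IH k.+1 ltd' Q'.
have D1 := letter_dom lti; have D2 := letter_dom (ltnW lti).
have D3 := letter_dom (settled_lt Q2); have L1 := s_noninc lti.
exists k', i'; split=> //; first exact: Ltrans L2 L1.
apply: contraNneq n2 => E; apply/eqP; apply: Lanti => //.
by rewrite L2 E L1.
Qed.

End DescendingLetters.

Lemma omega_pow_descent A X f : is_linear_order X -> computes_LO A X ->
  computes_fun A f -> descending (omega_pow X) f ->
  exists g, computes_fun (jump A) g /\ descending X g.
Proof.
move=> /linear_lebP[_ N T _] [_ HL] Hf desc; pose s i := CodeSeq.decode (f i).
have sD i : all (domb X) (s i) by have [/ldom_omega_pow[]] := desc i.
have sL i k : k.+1 < size (s i) -> leb X (nth 0 (s i) k.+1) (nth 0 (s i) k).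
  by move=> lt; apply/asboolP; have [/ldom_omega_pow[_ H] _] := desc i; apply: H.
have sd i : lexle true (leb X) (s i.+1) (s i) && (s i.+1 != s i).
  have [_ [/str_leP -> ne]] := desc i; apply/eqP => E; apply: ne.
  exact: (can_inj CodeSeq.decodeK).
pose val p := nth 0 (s (nsnd p)) (nfst p).
pose unsettled p := `[< exists j, (nsnd p <= j) && ~~ agree_below (nfst p) (s (nsnd p)) (s j) >].
have unsettledP p : reflect (settled s (nfst p) (nsnd p)) (~~ unsettled p).
  apply: (iffP negP) => [H j le|H /asboolP[j /andP[le /negP]]].
    by apply/negPn/negP => n; apply: H; apply/asboolP; exists j; rewrite le.
  by apply; apply: H.
(* An unsettled [p] accepts every [q], which makes the search total; the iteration from the settled
   pair (0, 0) never meets such a [p]. *)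
pose next q p := unsettled p || [&& ~~ unsettled q, leb X (val q) (val p) & val q != val p].
have next_ex p : exists q, next q p.
  rewrite /next; case: (boolP (unsettled p)) => [_|/unsettledP Q]; first by exists 0.
  have [k [i [Q' L' n']]] := settled_next N T sD sL sd Q.
  exists (npair k i); rewrite /val !npairE L' n' !andbT.
  by apply/unsettledP; rewrite !npairE.
have liftA := computes_fun_trans (jump_computes A).
have Hval u : computes_fun (jump A) u -> computes_fun (jump A) (fun x => val (u x)).
  by move=> Hu; apply: (computes_comp (f := val)) => //; apply: liftA;
    rewrite /val /s; have := computes_comp Hf (computes_nsnd (computes_id A)); cpt.
have Huns u : computes_fun (jump A) u -> computes_fun (jump A) (fun x => nat_of_bool (unsettled (u x))).
  apply: (computes_comp (f := fun x => nat_of_bool (unsettled x))).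
  apply: (computes_sigma1 (P := fun j p => (nsnd p <= j) &&
    ~~ agree_below (nfst p) (s (nsnd p)) (s j))).
  have Hf' u' : computes_fun A u' -> computes_fun A (fun x => f (u' x)) by exact: computes_comp.
  by rewrite /agree_below /s; cpt.
have HL' u v : computes_fun (jump A) u -> computes_fun (jump A) v ->
    computes_fun (jump A) (fun x => nat_of_bool (leb X (u x) (v x))).
  by move=> Hu Hv; apply: (computes2 (F := fun x y => nat_of_bool (leb X x y))) => //; apply: liftA.
have [h [Hh hP]] : exists h, computes_fun (jump A) h /\ forall p, next (h p) p.
  by apply: computes_search next_ex; rewrite /next; cpt.
pose st m := nat_rect (fun _ => nat) (npair 0 0) (fun _ p => h p) m.
have Hst : computes_fun (jump A) st.
  apply: (@computes_rec _ (fun=> npair 0 0) (fun x => x) (fun _ p _ => h p)); [cpt| |cpt].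
  by apply: (computes_comp Hh); cpt.
have st_settled m : ~~ unsettled (st m).
  elim: m => [|m IH]; first by apply/unsettledP; rewrite !npairE; exact: (settled00 sd).
  by have := hP (st m); rewrite /next (negbTE IH) => /and3P[].
exists (fun m => val (st m)); split; first exact: Hval.
move=> m; split.
  apply/asboolP/(letter_dom sD).
  by apply: (settled_lt (s := s)); apply/unsettledP/st_settled.
have := hP (st m); rewrite /next (negbTE (st_settled m)) => /and3P[_ /asboolP L' /eqP n'].
by split.
Qed.

Lemma computes_LO_trans A B X : computes_set B A -> computes_LO A X -> computes_LO B X.
Proof. by move=> BA [HD HL]; split; apply: computes_fun_trans BA _. Qed.

Lemma computable_LO_computes X : computable_LO X -> computes_LO emptyset X.
Proof. by move=> [/computes_setE HD /computes_setE HL]; split. Qed.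

Lemma omega_iter_linear n X : is_linear_order X -> is_linear_order (omega_iter n X).
Proof. by elim: n => // n IH /IH; apply: omega_pow_linear. Qed.

Lemma omega_iter_computes A n X : computes_LO A X -> computes_LO A (omega_iter n X).
Proof. by elim: n => // n IH /IH; apply: omega_pow_computes. Qed.

(** The induction varies the oracle: removing the outermost exponential replaces [A] by its jump,
    relative to which X is still computable. *)
Lemma omega_iter_descent n A X f : is_linear_order X -> computes_LO A X ->
  computes_fun A f -> descending (omega_iter n X) f ->
  exists g, computes_fun (jumpn n A) g /\ descending X g.
Proof.
elim: n A f => [|n IH] A f linX HX Hf desc; first by exists f.
have [g [Hg dg]] := omega_pow_descent (omega_iter_linear n linX)
  (omega_iter_computes n HX) Hf desc.
rewrite /jumpn iterSr; apply: IH dg => //.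
exact: computes_LO_trans (jump_computes A) HX.
Qed.

(** * Trees of stages *)

Definition tree_order (R : rel nat) : Prop :=
  [/\ reflexive R, forall s t, R s t -> s <= t, transitive R, forall t, R 0 t &
      forall r s t, R r t -> R s t -> r <= s -> R r s].

(** The largest proper predecessor; the search over an empty range makes the root its own parent. *)
Definition parent (R : rel nat) (t : nat) : nat :=
  find (fun p => R p t && all (fun q => R q t ==> (q <= p)) (iota 0 t)) (iota 0 t).

Definition branch (R : rel nat) (x : nat) : seq nat := [seq q <- iota 0 x.+1 | R q x].

Lemma leq_tree : tree_order leq.
Proof. by split=> //; exact: leq_trans. Qed.

Lemma uniq_cat_cons (T : eqType) (q p w u : seq T) a :
  uniq (q ++ a :: w) -> q ++ a :: w = p ++ a :: u -> q = p.
Proof.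
elim: q p => [|b q IH] [|c p] //=.
- by move=> /andP[nw _] [_ E]; move: nw; rewrite E mem_cat inE eqxx orbT.
- by move=> /andP[nq _] [E _]; move: nq; rewrite E mem_cat inE eqxx orbT.
- by move=> /andP[_ U] [-> E]; rewrite (IH p).
Qed.

Section Tree.
Variable R : rel nat.
Hypothesis treeR : tree_order R.

Let Rxx : reflexive R. Proof. by case: treeR. Qed.
Let Rle s t : R s t -> s <= t. Proof. by case: treeR => _ H _ _ _; apply: H. Qed.
Let Rtrans : transitive R. Proof. by case: treeR. Qed.
Let R0 t : R 0 t. Proof. by case: treeR. Qed.
Let Rlin r s t : R r t -> R s t -> r <= s -> R r s.
Proof. by case: treeR => _ _ _ _ H; apply: H. Qed.

Lemma parentP t : 0 < t ->
  [/\ parent R t < t, R (parent R t) t & forall q, q < t -> R q t -> R q (parent R t)].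
Proof.
move=> t_gt0; pose Q p := R p t && all (fun q => R q t ==> (q <= p)) (iota 0 t).
have hasQ : has Q (iota 0 t).
  have ex : exists p, (p < t) && R p t by exists 0; rewrite t_gt0 R0.
  have ub p : (p < t) && R p t -> p <= t by move=> /andP[/ltnW].
  have [m /andP[ltm Rm] maxm] := ex_maxnP ex ub.
  apply/hasP; exists m; first by rewrite mem_iota.
  rewrite /Q Rm; apply/allP => q; rewrite mem_iota => /andP[_ lt].
  by apply/implyP => Rq; apply: maxm; rewrite lt.
have lt : parent R t < t by have := hasQ; rewrite has_find size_iota.
have := nth_find 0 hasQ; rewrite nth_iota // add0n -/(parent R t) => /andP[Rp /allP maxp].
split=> // q ltq Rq; apply: (Rlin Rq Rp).
by have := maxp q; rewrite mem_iota ltq Rq; apply.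
Qed.

Lemma mem_branch q x : (q \in branch R x) = R q x.
Proof.
rewrite mem_filter mem_iota /= add0n ltnS.
by case E : (R q x) => //=; rewrite (Rle E).
Qed.

Lemma branch_uniq x : uniq (branch R x).
Proof. exact/filter_uniq/iota_uniq. Qed.

Lemma branch_sorted x : sorted ltn (branch R x).
Proof. by apply: sorted_filter; [exact: ltn_trans | exact: iota_ltn_sorted]. Qed.

Lemma branch_cat y x : R y x ->
  branch R x = branch R y ++ [seq q <- iota y.+1 (x - y) | R q x].
Proof.
move=> Ryx; have -> : branch R x = [seq q <- iota 0 y.+1 ++ iota y.+1 (x - y) | R q x].
  by rewrite -[iota y.+1 _]/(iota (0 + y.+1) _) -iotaD addSn (subnKC (Rle Ryx)).
rewrite filter_cat; congr (_ ++ _); apply: eq_in_filter => q; rewrite mem_iota /= add0n ltnS => leq.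
by apply/idP/idP => [Rqx|Rqy]; [exact: (Rlin Rqx Ryx) | exact: Rtrans Ryx].
Qed.

Lemma branch0 : branch R 0 = [:: 0].
Proof. by rewrite /branch /= R0. Qed.

Lemma branch_parent x : 0 < x -> branch R x = rcons (branch R (parent R x)) x.
Proof.
move=> /parentP[lt Rp maxp]; rewrite (branch_cat Rp) -cats1; congr (_ ++ _).
have [d Ed] : exists d, x = (parent R x + d).+1.
  by exists (x - (parent R x).+1); rewrite -addSn subnKC.
have -> : x - parent R x = d.+1 by rewrite {1}Ed -addnS addKn.
rewrite -[d.+1]addn1 iotaD filter_cat addSn -Ed /= Rxx.
rewrite (eq_in_filter (a2 := pred0)) ?filter_pred0 // => q; rewrite mem_iota addSn -Ed.
by case/andP => ltq ltqx; apply/negP => /(maxp _ ltqx)/Rle; rewrite leqNgt ltq.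
Qed.

Lemma branch_rcons x : exists p, branch R x = rcons p x.
Proof.
case: (posnP x) => [->|/branch_parent ->]; last by eexists.
by exists [::]; rewrite branch0.
Qed.

Lemma branch_inj : injective (branch R).
Proof.
move=> x y E; have [p Ex] := branch_rcons x; have [q Ey] := branch_rcons y.
by have := congr1 (last 0) E; rewrite Ex Ey !last_rcons.
Qed.

Lemma branch_prefix x p a u : branch R x = p ++ a :: u -> branch R a = rcons p a.
Proof.
move=> E; have Rax : R a x by rewrite -mem_branch E mem_cat inE eqxx orbT.
have [q Ea] := branch_rcons a; have := branch_uniq x.
have := E; rewrite (branch_cat Rax) Ea cat_rcons => Eqp Uq.
by rewrite (uniq_cat_cons Uq Eqp).
Qed.

Lemma branch_head x : exists u, branch R x = 0 :: u.
Proof. by rewrite (branch_cat (R0 x)) branch0; eexists. Qed.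

(** All branches start at the root, so they first differ at two children of a common node. *)
Lemma branch_split x y p a c u v : branch R x = p ++ a :: u -> branch R y = p ++ c :: v ->
  a != c -> [/\ 0 < a, 0 < c, parent R a = parent R c, p = branch R (parent R a)
    & R a x /\ R c y].
Proof.
move=> Ex Ey n; have Ea := branch_prefix Ex; have Ec := branch_prefix Ey.
have p_ne : p != [::].
  apply: contra n => /eqP p0; have [u0 E0] := branch_head x; have [v0 F0] := branch_head y.
  by move: Ex Ey; rewrite E0 F0 p0 => -[<- _] [<- _].
have gt0 d : branch R d = rcons p d -> 0 < d.
  case: d => //; rewrite branch0 => E; case/negP: p_ne.
  by case: p E {Ex Ey Ea Ec} => // e [].
have /gt0 a_gt0 := Ea; have /gt0 c_gt0 := Ec.
have Ep : p = branch R (parent R a).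
  by move: Ea; rewrite branch_parent // => /rcons_inj[].
have Ep' : p = branch R (parent R c).
  by move: Ec; rewrite branch_parent // => /rcons_inj[].
split=> //; first by apply: branch_inj; rewrite -Ep.
by rewrite -!mem_branch Ex Ey !mem_cat !inE !eqxx !orbT.
Qed.

End Tree.

(* [priority] depends only on the parent, so siblings have equal priority. *)
Definition priority (R : rel nat) (beta : nat -> nat) (t : nat) : nat :=
  if t == 0 then 0 else beta (parent R t).

(** Along the [R]-branch of [t], the surviving stages are the weak right-to-left minima of
    [priority]; with [entry] for [beta] they are the stages that look true at [t]. *)
Definition refine (R : rel nat) (beta : nat -> nat) : rel nat := fun s t =>
  R s t && all (fun r => (s <= r) && R r t ==> (priority R beta s <= priority R beta r))
    (iota 0 t.+1).

Section Refine.
Variables (R : rel nat) (beta : nat -> nat).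
Hypothesis treeR : tree_order R.
Local Notation R' := (refine R beta).
Local Notation pri := (priority R beta).

Let Rxx : reflexive R. Proof. by case: treeR. Qed.
Let Rle s t : R s t -> s <= t. Proof. by case: treeR => _ H _ _ _; apply: H. Qed.
Let Rtrans : transitive R. Proof. by case: treeR. Qed.
Let R0 t : R 0 t. Proof. by case: treeR. Qed.
Let Rlin r s t : R r t -> R s t -> r <= s -> R r s.
Proof. by case: treeR => _ _ _ _ H; apply: H. Qed.

Lemma refineP s t : reflect (R s t /\ forall r, s <= r -> R r t -> pri s <= pri r) (R' s t).
Proof.
apply: (iffP andP) => -[Rst H]; split=> //.
  move=> r sr Rrt; apply: (implyP (allP H r _)); last by rewrite sr.
  by rewrite mem_iota /= add0n ltnS Rle.
by apply/allP => r _; apply/implyP => /andP[]; apply: H.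
Qed.

Lemma refine_sub s t : R' s t -> R s t.
Proof. by case/andP. Qed.

Lemma refine_restrict s r t : R' s t -> R s r -> R r t -> R' s r.
Proof.
move=> /refineP[_ H] Rsr Rrt; apply/refineP; split=> // q sq Rqr.
by apply: H => //; apply: Rtrans Rrt.
Qed.

Lemma refine_tree : tree_order R'.
Proof.
split.
- by move=> t; apply/refineP; split=> // r tr /Rle rt; rewrite (@anti_leq t r) ?tr.
- by move=> s t /refine_sub/Rle.
- move=> r s t /refineP[Rsr Hs] /refineP[Rrt Hr]; apply/refineP; split; first exact: Rtrans Rrt.
  move=> q sq Rqt; case: (leqP r q) => [rq|/ltnW qr].
    by apply: leq_trans (Hr _ rq Rqt); apply: Hs => //; apply: Rle.
  by apply: Hs => //; apply: Rlin Rqt Rrt qr.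
- by move=> t; apply/refineP.
- move=> r s t R'rt /refine_sub Rst rs.
  exact: (refine_restrict R'rt (Rlin (refine_sub R'rt) Rst rs) Rst).
Qed.

Lemma refine_parent q a : q < a -> R' q a = R' q (parent R a) && (pri q <= pri a).
Proof.
move=> qa; have a_gt0 : 0 < a by apply: leq_ltn_trans qa.
have [pa Rpa maxp] := parentP treeR a_gt0.
apply/idP/andP => [R'qa|[/refineP[Rqp H] le]].
  have Rqp := maxp _ qa (refine_sub R'qa).
  split; first exact: refine_restrict R'qa Rqp Rpa.
  by case/refineP: R'qa => _; apply=> //; apply: ltnW.
apply/refineP; split=> [|r qr Rra]; first exact: Rtrans Rpa.
have := Rle Rra; rewrite leq_eqVlt => /orP[/eqP -> //|ra].
by apply: H => //; apply: maxp.
Qed.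

(** By [refine_parent], the proper predecessors of a stage in the refined tree depend only on its
    [R]-parent and its priority, and siblings share both. *)
Lemma sibling_refine a c : 0 < a -> 0 < c -> parent R a = parent R c ->
  parent R' a = parent R' c.
Proof.
move=> a_gt0 c_gt0 E.
suff le a' c' : 0 < a' -> 0 < c' -> parent R a' = parent R c' -> parent R' a' <= parent R' c'.
  by apply: anti_leq; rewrite !le.
move: a' c' => {a c a_gt0 c_gt0 E} a c a_gt0 c_gt0 E.
have [pa Rpa _] := parentP refine_tree a_gt0.
have [_ _ maxc] := parentP refine_tree c_gt0.
have [pc _ _] := parentP treeR c_gt0.
move: Rpa; rewrite refine_parent // => /andP[Rpp le].
have pltc : parent R' a < c.
  by apply: leq_ltn_trans pc; rewrite -E; apply: Rle; apply: refine_sub Rpp.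
apply: Rle; apply: refine_sub; apply: maxc => //; rewrite refine_parent // -E Rpp.
by move: le; rewrite /priority (gtn_eqF a_gt0) (gtn_eqF c_gt0) E.
Qed.

End Refine.

(** * Kleene-Brouwer orders on stages and the embedding *)

Definition linear_rel (L : rel nat) : Prop :=
  [/\ reflexive L, antisymmetric L, transitive L & total L].

Definition kb (L : rel nat) (f : nat -> seq nat) : rel nat := fun x y => lexle false L (f x) (f y).

Lemma kb_linear L f : linear_rel L -> injective f -> linear_rel (kb L f).
Proof.
move=> [R N T O] finj.
have N' : {in predT &, antisymmetric L} by move=> x y _ _; apply: N.
have T' : {in predT & &, transitive L} by move=> x y z _ _ _; apply: T.
have O' : {in predT &, total L} by move=> x y _ _; apply: O.
split.
- by move=> x; apply: lexle_refl.
- by move=> x y /andP[H1 H2]; apply/finj/(lexle_anti N' _ _ H1 H2); apply: all_predT.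
- by move=> y x z; apply: (lexle_trans N' T'); apply: all_predT.
- by move=> x y; apply: (lexle_total false O'); apply: all_predT.
Qed.

Definition by_parent (R S : rel nat) : rel nat := fun a c =>
  if parent R a == parent R c then S a c else parent R a <= parent R c.

Lemma by_parent_linear R S : linear_rel S -> linear_rel (by_parent R S).
Proof.
move=> [Sr Sa St So]; rewrite /by_parent; split.
- by move=> x; rewrite eqxx.
- move=> x y; rewrite [parent R y == _]eq_sym; case: eqP => [_|n]; first exact: Sa.
  by move/anti_leq.
- move=> y x z; case: (parent R x =P _) => [->|n1].
    by case: eqP => // _; apply: St.
  case: (parent R y =P _) => [<-|n2]; first by case: eqP.
  case: eqP => [-> l1 l2|_]; last exact: leq_trans.
  by case: n2; apply: anti_leq; rewrite l1 l2.
- move=> x y; rewrite [parent R y == _]eq_sym; case: eqP => _; first exact: So.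
  exact: leq_total.
Qed.

(** The stages on the [R]-branch of [x] that compete with [x] for the same place in the refined
    tree. *)
Definition sibling_branch (R R' : rel nat) (x : nat) : seq nat :=
  [seq q <- branch R x | parent R' q == parent R' x].

Lemma sibling_branch_rcons R R' x : tree_order R ->
  exists p, sibling_branch R R' x = rcons p x.
Proof.
move=> treeR; have [p E] := branch_rcons treeR x.
by rewrite /sibling_branch E filter_rcons eqxx; eexists.
Qed.

Lemma sibling_branch_inj R R' : tree_order R -> injective (sibling_branch R R').
Proof.
move=> treeR x y E.
have [p Ex] := sibling_branch_rcons R' x treeR; have [q Ey] := sibling_branch_rcons R' y treeR.
by have := congr1 (last 0) E; rewrite Ex Ey !last_rcons.
Qed.

(* Siblings of the refined tree are compared along their [R]-branches, letters
   with different parents by the number of the parent. Comparing those by [S] as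
   well would let false stages descend along the infinite path of [R]. *)
Definition next_sibling_order (R R' S : rel nat) : rel nat :=
  kb (by_parent R S) (sibling_branch R R').

Definition tree_kb (R S : rel nat) : rel nat := kb S (branch R).

Section Step.
Variables (R S : rel nat) (beta : nat -> nat).
Hypothesis treeR : tree_order R.
Hypothesis linS : linear_rel S.
Local Notation R' := (refine R beta).
Local Notation S' := (next_sibling_order R R' S).
Local Notation X' := (tree_kb R' S').
Let treeR' := refine_tree beta treeR.

Let Rle s t : R s t -> s <= t. Proof. by case: treeR => _ H _ _ _; apply: H. Qed.
Let Rtrans : transitive R. Proof. by case: treeR. Qed.
Let Rlin r s t : R r t -> R s t -> r <= s -> R r s.
Proof. by case: treeR => _ _ _ _ H; apply: H. Qed.

Lemma next_sibling_linear : linear_rel S'.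
Proof. by apply: kb_linear; [exact: by_parent_linear | exact: sibling_branch_inj]. Qed.

(** [a] and [c] are still siblings after refinement, and their sibling branches differ in the last
    letter only. *)
Lemma sibling_lt a c : 0 < a -> 0 < c -> parent R a = parent R c -> a != c -> S a c -> X' a c.
Proof.
move=> a_gt0 c_gt0 E n Sac; have E' := sibling_refine beta treeR a_gt0 c_gt0 E.
rewrite /tree_kb /kb (branch_parent treeR' a_gt0) (branch_parent treeR' c_gt0) -E' -!cats1 lexle_cat /= (negbTE n).
rewrite /next_sibling_order /kb /sibling_branch.
rewrite (branch_parent treeR a_gt0) (branch_parent treeR c_gt0) !filter_rcons !eqxx.
by rewrite E E' -!cats1 lexle_cat /= (negbTE n) /by_parent E eqxx.
Qed.

(** Let [r] be the first [R']-predecessor of [x] beyond [q], and [d] its [R']-parent, which is an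
    [R']-predecessor of [q]. If [q = d], the branch of [x] extends that of [q]. Otherwise the branch
    of [q] leaves [d] through some [c] with [R c r]; the sibling branch of [r] then extends that of
    [c], which puts [r] below [c]. *)
Lemma extension_lt q x : R q x -> q < x -> X' x q.
Proof.
move=> Rqx qx; have [R'xx _ R't _ _] := treeR'.
have ex : exists r, (q < r) && R' r x by exists x; rewrite qx R'xx.
have [r /andP[qr R'rx] minr] := ex_minnP ex.
have r_gt0 : 0 < r by apply: leq_ltn_trans qr.
have [dr R'dr _] := parentP treeR' r_gt0; set d := parent R' r in dr R'dr.
have R'dx : R' d x by apply: R't R'rx.
have dq : d <= q.
  by rewrite leqNgt; apply/negP => qd; have := minr d; rewrite qd R'dx leqNgt dr => /(_ isT).
have Rdq : R d q by apply: (Rlin (refine_sub R'dx) Rqx dq).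
have R'dq : R' d q by apply: refine_restrict R'dx Rdq Rqx.
have [W EW] : exists W, branch R' x = branch R' d ++ r :: W.
  by rewrite (branch_cat treeR' R'rx) (branch_parent treeR' r_gt0) -cats1 -catA; eexists.
rewrite /tree_kb /kb EW; have := branch_cat treeR' R'dq.
case: {EW}[seq _ <- _ | _] (EW) => [|c C] Ex Eq.
  by rewrite Eq lexle_cat.
rewrite Eq lexle_cat /=.
have R'cq : R' c q by rewrite -(mem_branch treeR') Eq mem_cat inE eqxx orbT.
have cq : c <= q by apply: Rle; apply: refine_sub R'cq.
have n : r != c by rewrite neq_ltn (leq_ltn_trans cq qr) orbT.
rewrite (negbTE n); have [_ _ Ep _ _] := branch_split treeR' Ex Eq n.
have Rcr : R c r.
  by apply: Rtrans (refine_sub R'cq) _; apply: (Rlin Rqx (refine_sub R'rx) (ltnW qr)).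
rewrite /next_sibling_order /kb /sibling_branch (branch_cat treeR Rcr) filter_cat Ep.
by rewrite -{2}[[seq _ <- branch R c | _]]cats0 lexle_cat; case: filter.
Qed.

Lemma tree_kb_embed x y : tree_kb R S x y -> x != y ->
  lexle true X' (rcons (branch R x) x) (rcons (branch R y) y) &&
  (rcons (branch R x) x != rcons (branch R y) y).
Proof.
move=> /lexleP[/(branch_inj treeR) -> /eqP //|H] nxy; apply/andP; split; last first.
  by apply: contra nxy => /eqP/rcons_inj[_ ->].
case: H => [[r [u E]]|[p [a [c [u [v [Ex Ey n Sac]]]]]]].
  rewrite E rcons_cat -[rcons (branch R y) y]cats1 lexle_cat /=.
  have U := branch_uniq R x; rewrite E cat_uniq /= in U.
  have yin : y \in branch R y by rewrite mem_branch //; case: treeR.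
  have nr : r \notin branch R y by case/and3P: U => _; case: (r \in _).
  have n : r != y by apply: contraNneq nr => ->.
  have Rrx : R r x by rewrite -mem_branch // E mem_cat inE eqxx orbT.
  have Ryx : R y x by rewrite -mem_branch // E mem_cat yin.
  have yr : y < r.
    rewrite ltnNge; apply: contra nr => ry; rewrite mem_branch //.
    exact: (Rlin Rrx Ryx ry).
  by rewrite (negbTE n); apply: extension_lt => //; apply: (Rlin Ryx Rrx (ltnW yr)).
have [a0 c0 E _ _] := branch_split treeR Ex Ey n.
by rewrite Ex Ey !rcons_cat lexle_cat /= (negbTE n); apply: sibling_lt.
Qed.

(** Each letter of a branch extends the one before it and so is smaller; the doubled letter gives
    the only step that is not strict. *)
Lemma tree_kb_embed_noninc x i : i.+1 < size (rcons (branch R x) x) ->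
  X' (nth 0 (rcons (branch R x) x) i.+1) (nth 0 (rcons (branch R x) x) i).
Proof.
rewrite size_rcons ltnS leq_eqVlt => /orP[/eqP E|lt].
  rewrite !nth_rcons E ltnn eqxx.
  have [p Ep] := branch_rcons treeR x; rewrite -E ltnS leqnn.
  have -> : nth 0 (branch R x) i = x.
    by move: E; rewrite Ep size_rcons => -[->]; rewrite nth_rcons ltnn eqxx.
  exact: lexle_refl.
rewrite !nth_rcons lt (ltnW lt); set a := nth _ _ i; set c := nth _ _ i.+1.
have ac : a < c by apply: (sorted_ltn_nth ltn_trans 0 (branch_sorted R x)) => //; apply: ltnW.
apply: (extension_lt _ ac); apply: (Rlin (t := x) _ _ (ltnW ac));
  by rewrite -mem_branch // mem_nth // ltnW.
Qed.

End Step.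

(** * Infinite paths and limits of descending sequences *)

Definition infinite_path (R : rel nat) (P : nat -> Prop) : Prop :=
  [/\ forall m, exists2 s, P s & m < s, forall s t, P s -> P t -> s <= t -> R s t &
      forall s t, R s t -> P t -> P s].

Definition refine_path (R : rel nat) (beta : nat -> nat) (P : nat -> Prop) : nat -> Prop :=
  fun s => P s /\ forall r, P r -> s <= r -> priority R beta s <= priority R beta r.

Section Paths.
Variables (R : rel nat) (beta : nat -> nat) (P : nat -> Prop).
Hypothesis treeR : tree_order R.
Hypothesis pathP : infinite_path R P.
Local Notation R' := (refine R beta).
Local Notation P' := (refine_path R beta P).

Lemma refine_path_believed s t : P' s -> P t -> s <= t -> R' s t.
Proof.
case: pathP => _ Plin Pdown [Ps H] Pt st; apply/refineP => //; split; first exact: Plin.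
by move=> r sr Rrt; apply: H => //; apply: Pdown Rrt Pt.
Qed.

Lemma refine_path_infinite : infinite_path R' P'.
Proof.
case: (pathP) => Pinf Plin Pdown; split.
(* A path stage of least priority beyond [m] is never undercut later. *)
- move=> m; have ex : exists k, `[< exists r, [/\ P r, m < r & priority R beta r = k] >].
    by have [r Pr mr] := Pinf m; exists (priority R beta r); apply/asboolP; exists r.
  have [k /asboolP[s [Ps ms <-]] min] := ex_minnP ex.
  exists s => //; split=> // r Pr sr; apply: min; apply/asboolP.
  by exists r; split=> //; apply: leq_trans sr.
- by move=> s t Ps [Pt _]; apply: refine_path_believed.
- move=> s t R'st [Pt Ht]; have Ps := Pdown _ _ (refine_sub R'st) Pt; split=> // r Pr sr.
  move/refineP: R'st => /(_ treeR)[Rst Hs].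
  case: (leqP r t) => [rt|/ltnW tr]; first by apply: Hs => //; apply: Plin.
  apply: leq_trans (Ht r Pr tr); apply: Hs => //; last by case: treeR.
  by case: treeR => _ le _ _ _; apply: le.
Qed.

End Paths.

(** If every value changed later, iterating a choice of such changes would produce a strictly
    descending subsequence. *)
Lemma eventually_const (L : rel nat) (a : nat -> nat) i0 :
  (forall i j, i0 <= i -> i < j -> a j = a i \/ L (a j) (a i)) ->
  (forall h : nat -> nat, (forall m, i0 <= h m) -> ~ strictly_desc L (a \o h)) ->
  exists2 i, i0 <= i & forall j, i <= j -> a j = a i.
Proof.
move=> mono nodesc; apply: contrapT => H.
have H1 i : exists j, i0 <= i -> i < j /\ a j <> a i.
  have [le|_] := leqP i0 i; last by exists 0.
  apply: contrapT => H1; apply: H; exists i => // j ij; apply: contrapT => n.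
  apply: H1; exists j => _; split=> //; rewrite ltn_neqAle ij andbT.
  by apply/eqP => E; apply: n; rewrite E.
have [f Hf] := choice H1; pose h m := iter m f i0.
have h_ge m : i0 <= h m by elim: m => //= m IH; apply: leq_trans IH (ltnW (proj1 (Hf _ IH))).
apply: (nodesc h) => // m; have [lt /eqP n] := Hf _ (h_ge m); rewrite /= n andbT.
by case: (mono _ _ (h_ge m) lt) => // /eqP E; rewrite E in n.
Qed.

(** Letters stabilise one position at a time: once those before position k are fixed, letter k can
    only descend. Hypothesis [nodesc] is restricted to letters that follow a common prefix, because
    the order on letters is well-founded among siblings only. *)
Lemma kb_limit (L : rel nat) (B : nat -> seq nat) : linear_rel L ->
  (forall i, lexle false L (B i.+1) (B i) && (B i.+1 != B i)) ->
  (forall p g, (forall m, exists i u, B i = p ++ g m :: u) -> ~ strictly_desc L g) ->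
  exists c : nat -> nat, forall k, exists i, forall j, i <= j ->
    k < size (B j) /\ nth 0 (B j) k = c k.
Proof.
move=> [_ N T _] desc nodesc.
have N' : {in predT &, antisymmetric L} by move=> x y _ _; apply: N.
have T' : {in predT & &, transitive L} by move=> x y z _ _ _; apply: T.
have lt i j (ij : i < j) := lexle_desc_lt N' T' (fun i => all_predT (B i)) desc ij.
have stab k : exists i, forall j, i <= j ->
    [/\ k < size (B j), take k (B j) = take k (B i) & nth 0 (B j) k = nth 0 (B i) k].
  have step k' i0 : (forall j, i0 <= j -> k' < size (B j) /\ take k' (B j) = take k' (B i0)) ->
      exists2 i, i0 <= i & forall j, i <= j -> nth 0 (B j) k' = nth 0 (B i) k'.
    move=> H; pose p := take k' (B i0).
    have EB j : i0 <= j -> B j = p ++ nth 0 (B j) k' :: drop k'.+1 (B j).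
      by move=> /H[ltk Et]; rewrite /p -Et -drop_nth // cat_take_drop.
    apply: (@eventually_const L (fun j => nth 0 (B j) k')) => [i j le ij|h hge].
      have /andP[] := lt _ _ ij; rewrite (EB i) // (EB j) ?(leq_trans le (ltnW ij)) //.
      rewrite lexle_cat /= -(EB i) // -(EB j) ?(leq_trans le (ltnW ij)) //.
      by case: eqP => [->|_]; [left | right].
    by apply: (nodesc p) => m; exists (h m), (drop k'.+1 (B (h m))); apply: EB.
  elim: k => [|k [i0 IH]].
    (* The empty string is the greatest one, so only [B 0] can be empty. *)
    have ne j : 1 <= j -> 0 < size (B j) /\ take 0 (B j) = take 0 (B 1).
      case: j => // j _; rewrite !take0; split=> //; have := desc j.
      by case: (B j.+1) => //; case: (B j).
    by have [i i1 Hi] := step 0 1 ne; exists i => j ij; rewrite !take0;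
      have [] := ne j (leq_trans i1 ij); rewrite Hi.
  have Et j : i0 <= j -> take k.+1 (B j) = take k.+1 (B i0).
    move=> le; have [l1 t1 n1] := IH j le; have [l0 t0 n0] := IH i0 (leqnn _).
    by rewrite !(take_nth 0) // t1 n1.
  (* A string ending after letter [k] would be a prefix of [B i0], hence not below it; this needs
     [j] to be strictly beyond [i0]. *)
  have long j : i0.+1 <= j -> k.+1 < size (B j) /\ take k.+1 (B j) = take k.+1 (B i0.+1).
    move=> le; rewrite (Et j) ?(Et i0.+1) //; last exact: ltnW.
    split=> //; have [l1 _ _] := IH j (ltnW le).
    rewrite ltn_neqAle l1 andbT; apply/eqP => E.
    have Ej : B j = take k.+1 (B i0) by rewrite -(Et j (ltnW le)) E take_size.
    have /andP[] := lt _ _ le; rewrite -[B i0](cat_take_drop k.+1) -Ej.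
    rewrite -{1}[B j]cats0 lexle_cat; case: (drop _ _) => //.
    by rewrite cats0 eqxx.
  have [i le Hi] := step k.+1 i0.+1 long; exists i => j ij.
  have [l1 ->] := long j (leq_trans le ij); have [_ ->] := long i le.
  by rewrite Hi.
have lim k : exists v, exists i, forall j, i <= j -> k < size (B j) /\ nth 0 (B j) k = v.
  by have [i Hi] := stab k; exists (nth 0 (B i) k), i => j /Hi[].
by have [c Hc] := choice lim; exists c.
Qed.

Lemma no_strictly_desc_leq g : ~ strictly_desc leq g.
Proof.
move=> desc; have H m : g m + m <= g 0.
  elim: m => [|m IH]; first by rewrite addn0.
  by apply: leq_trans IH; rewrite addnS -addSn leq_add2r ltn_neqAle andbC desc.
by have := leq_trans (leq_addl _ _) (H (g 0).+1); rewrite ltnn.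
Qed.

Definition sibling_wf (R S : rel nat) : Prop := forall g,
  (forall i, parent R (g i) = parent R (g 0)) -> ~ strictly_desc S g.

Definition unique_path (R : rel nat) (P : nat -> Prop) : Prop := forall c : nat -> nat,
  (forall k, R (c k) (c k.+1) /\ c k < c k.+1) -> forall k, P (c k).

Lemma chain_unbounded (c : nat -> nat) : (forall k, c k < c k.+1) -> forall k, k <= c k.
Proof. by move=> H; elim=> // k IH; apply: leq_ltn_trans (H k). Qed.

Section Convergence.
Variables (R S : rel nat) (P : nat -> Prop).
Hypothesis treeR : tree_order R.
Hypothesis pathP : infinite_path R P.
Hypothesis linS : linear_rel S.
Hypothesis wfS : sibling_wf R S.
Hypothesis uniqP : unique_path R P.

(** A stage of [P] that undercuts [c k] would lie on the [R]-branch of a later [c j], contradicting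
    that [c k] is an [R']-predecessor of [c j]. *)
Lemma unique_path_refine beta : unique_path (refine R beta) (refine_path R beta P).
Proof.
move=> c Hc; have Hc' k : R (c k) (c k.+1) /\ c k < c k.+1.
  by have [/refine_sub] := Hc k.
have Pc := uniqP Hc'; move=> k; split=> // r Pr kr.
have [_ Plin _] := pathP; have [_ _ R't _ _] := refine_tree beta treeR.
have ck_gt j : k < j -> refine R beta (c k) (c j).
  elim: j => // j IH; rewrite ltnS leq_eqVlt => /orP[/eqP <-|/IH H]; first by have [] := Hc k.
  by apply: R't H _; have [] := Hc j.
have lt : k < maxn k.+1 r by rewrite leq_max leqnn.
have /(refineP _ treeR)[_ H] := ck_gt _ lt; apply: H => //; apply: Plin => //.
apply: leq_trans (chain_unbounded (fun k => proj2 (Hc k)) _).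
by rewrite leq_max leqnn orbT.
Qed.

Lemma limit_chain (B : nat -> seq nat) (x : nat -> nat) (c : nat -> nat) :
  (forall j, sorted ltn (B j)) -> (forall j, {in B j, forall q, R q (x j)}) ->
  (forall k, exists i, forall j, i <= j -> k < size (B j) /\ nth 0 (B j) k = c k) ->
  forall k, R (c k) (c k.+1) /\ c k < c k.+1.
Proof.
move=> sB RB lim k; have [i Hi] := lim k; have [i' Hi'] := lim k.+1.
have [lt <-] := Hi (maxn i i') (leq_maxl _ _).
have [lt' <-] := Hi' (maxn i i') (leq_maxr _ _).
set s := B _ in lt lt' *.
have ltc : nth 0 s k < nth 0 s k.+1 by apply: (sorted_ltn_nth ltn_trans 0 (sB _)).
split=> //; case: treeR => _ _ _ _ Rlin; apply: Rlin (ltnW ltc); apply: RB;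
  exact: mem_nth.
Qed.

(** The sibling branches of a descending sequence would converge to an infinite chain inside [P]
    with one common [R']-parent. But the refined path has a stage beyond that parent, and this stage
    is an [R']-predecessor of all later stages of [P]. *)
Lemma sibling_wf_next beta :
  sibling_wf (refine R beta) (next_sibling_order R (refine R beta) S).
Proof.
set R' := refine R beta => g sib desc; pose B i := sibling_branch R R' (g i).
have [|p h inB hdesc|c lim] := kb_limit (B := B) (by_parent_linear R linS).
- move=> i; have /andP[H n] := desc i; apply/andP; split; first exact: H.
  apply: contra n => /eqP E; apply/eqP.
  exact: sibling_branch_inj E.
(* The parents of the letters never increase as numbers, so they are eventually constant, and from
   there on [wfS] applies. *)
- have [||i _ Hi] := @eventually_const leq (fun m => parent R (h m)) 0.
  + move=> i j _; elim: j => // j IH; rewrite ltnS leq_eqVlt.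
    have le m : parent R (h m.+1) <= parent R (h m).
      by have /andP[] := hdesc m; rewrite /by_parent; case: eqP => [->|].
    case/orP => [/eqP ->|/IH H]; first by right.
    by right; apply: leq_trans (le j) _; case: H => [->|].
  + by move=> h' _; apply: no_strictly_desc_leq.
  apply: (wfS (g := fun m => h (i + m))) => [m|m].
    by rewrite !Hi ?leq_addr.
  have /andP[] := hdesc (i + m); rewrite -addnS /by_parent.
  by rewrite !Hi ?leq_addr // eqxx => -> ->.
have Bsub i q : q \in B i -> R q (g i) /\ parent R' q = parent R' (g 0).
  by rewrite mem_filter mem_branch // => /andP[/eqP -> Rq]; rewrite sib.
have chain : forall k, R (c k) (c k.+1) /\ c k < c k.+1.
  apply: (limit_chain (B := B) (x := g)) => // [j|j q /Bsub[]] //.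
  by apply: sorted_filter; [exact: ltn_trans | exact: branch_sorted].
have parc k : parent R' (c k) = parent R' (g 0).
  have [i Hi] := lim k; have [lt E] := Hi i (leqnn i).
  by rewrite -E; apply: (proj2 (Bsub i _ _)); apply: mem_nth.
have [Pinf' _ _] := refine_path_infinite beta treeR pathP.
have [u P'u ltu] := Pinf' (parent R' (g 0)).
have Pc := uniqP chain.
have ltuc : u < c u.+1 by apply: chain_unbounded => k; case: (chain k).
have R'uc := refine_path_believed treeR pathP P'u (Pc u.+1) (ltnW ltuc).
have treeR' := refine_tree beta treeR.
have [_ _ /(_ u ltuc R'uc)] := parentP treeR' (leq_ltn_trans (leq0n _) ltuc).
by rewrite parc; case: treeR' => _ le _ _ _ /le; rewrite leqNgt ltu.
Qed.

(** The branches of the terms converge to a chain [c] inside [P]. Since [s <= c s], the stage [s]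
    precedes [c s], which eventually belongs to every branch. *)
Lemma tree_kb_descent g s : strictly_desc (tree_kb R S) g -> P s ->
  exists i, forall j, i <= j -> R s (g j).
Proof.
move=> desc Ps; have [|p h inB hdesc|c lim] := kb_limit (B := fun i => branch R (g i)) linS.
- move=> i; have /andP[H n] := desc i; apply/andP; split; first exact: H.
  apply: contra n => /eqP E; apply/eqP.
  exact: branch_inj E.
- apply: (wfS (g := h)) (hdesc); elim=> // m <-.
  have [i [u Ei]] := inB m; have [j [v Ej]] := inB m.+1.
  by have /andP[_ n] := hdesc m; have [_ _ ->] := branch_split treeR Ej Ei n.
have chain : forall k, R (c k) (c k.+1) /\ c k < c k.+1.
  apply: (limit_chain (B := fun i => branch R (g i)) (x := g)) => // j; first exact: branch_sorted.
  by move=> q; rewrite mem_branch.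
have [_ Plin _] := pathP; have [_ _ Rtrans _ _] := treeR.
have Rsc : R s (c s).
  apply: (Plin _ _ Ps (uniqP chain s)).
  by apply: chain_unbounded => k; case: (chain k).
have [i Hi] := lim s; exists i => j /Hi[lt E]; apply: Rtrans Rsc _.
by rewrite -mem_branch // -E mem_nth.
Qed.

End Convergence.

(** * The jump of a path *)

(** Derivations up to [q] query only numbers below [q]; for [q] on the path, its predecessors answer
    these queries as the whole path does. *)
Definition halts_at (R : rel nat) (e q : nat) : bool :=
  has (kleeneT (fun x => R x q) e) (iota 0 q.+1).

(* The least number newly seen to enter the jump at stage [q], and [q] if there
   is none. *)
Definition entry (R : rel nat) (q : nat) : nat :=
  find (fun e => halts_at R e q && ~~ has (fun r => R r q && halts_at R e r) (iota 0 q))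
    (iota 0 q).

Section JumpFromPath.
Variables (R : rel nat) (P : nat -> Prop).
Hypothesis treeR : tree_order R.
Hypothesis pathP : infinite_path R P.

Let Pinf m : exists2 s, P s & m < s. Proof. by case: pathP. Qed.
Let Plin s t : P s -> P t -> s <= t -> R s t. Proof. by case: pathP => _ H _; apply: H. Qed.
Let Pdown s t : R s t -> P t -> P s. Proof. by case: pathP => _ _ H; apply: H. Qed.
Let Rle s t : R s t -> s <= t. Proof. by case: treeR => _ H _ _ _; apply: H. Qed.

Lemma kleeneT_path q e w : P q -> w <= q ->
  kleeneT (fun x => R x q) e w = kleeneT (fun x => `[< P x >]) e w.
Proof.
move=> Pq wq; apply: kleeneT_ext => x xw; apply/idP/asboolP => [Rxq|Px].
  exact: Pdown Rxq Pq.
by apply: Plin => //; apply: leq_trans (ltnW xw) wq.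
Qed.

Lemma halts_at_jump q e : P q -> halts_at R e q -> jump P e.
Proof.
move=> Pq /hasP[w]; rewrite mem_iota /= add0n ltnS => wq.
rewrite kleeneT_path // => T; rewrite -[P]oracle_asbool.
by apply/kleene_normal_form; exists w.
Qed.

Lemma jump_halts_at e : jump P e -> exists2 q, P q & halts_at R e q.
Proof.
move=> Je; have /kleene_normal_form[w T] : jump (fun x => `[< P x >]) e by rewrite oracle_asbool.
have [q Pq wq] := Pinf w; exists q => //; apply/hasP; exists w.
  by rewrite mem_iota /= add0n ltnS ltnW.
by rewrite kleeneT_path // ltnW.
Qed.

Lemma halts_at_ltn e q : halts_at R e q -> e < q.
Proof.
by case/hasP => w; rewrite mem_iota /= add0n ltnS => wq /kleeneT_ltn /leq_trans; apply.
Qed.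

Local Notation pri := (priority R (entry R)).

Lemma path_parent p r : P p -> P r -> p < r ->
  [/\ P (parent R r), p <= parent R r, parent R r < r & pri r = entry R (parent R r)].
Proof.
move=> Pp Pr pr; have r_gt0 : 0 < r by apply: leq_ltn_trans pr.
have [lt Rq maxq] := parentP treeR r_gt0; split=> //; first exact: Pdown Rq Pr.
  by apply/Rle/maxq => //; apply: Plin => //; apply: ltnW.
by rewrite /priority gtn_eqF.
Qed.

Lemma entry_halts q : entry R q < q ->
  halts_at R (entry R q) q /\ forall r, r < q -> R r q -> ~~ halts_at R (entry R q) r.
Proof.
move=> lt; pose Q e := halts_at R e q && ~~ has (fun r => R r q && halts_at R e r) (iota 0 q).
have hasq : has Q (iota 0 q) by rewrite has_find size_iota.
have := nth_find 0 hasq; rewrite -/(entry R q) nth_iota // add0n => /andP[-> /hasPn H]; split=> // r rq Rrq.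
by have := H r; rewrite mem_iota Rrq; apply.
Qed.

Lemma entry_le e q : halts_at R e q -> (forall r, r < q -> R r q -> ~~ halts_at R e r) ->
  entry R q <= e.
Proof.
move=> He first; have eq := halts_at_ltn He; rewrite leqNgt; apply/negP => lt.
have := before_find 0 lt; rewrite nth_iota // add0n He /= => /negbT/negPn/hasP[r].
by rewrite mem_iota => /andP[_ rq] /andP[/(first r rq)/negbTE ->].
Qed.

(** A number is newly seen by at most one stage of the path, the first at which it halts; the
    default value [q] of [entry] passes [k] as the stages grow. *)
Lemma priority_neq k : exists m, forall r, P r -> m < r -> pri r <> k.
Proof.
have [[q0 Pq0 Hq0]|no] := pselect (exists2 q0, P q0 & halts_at R k q0).
  have [p Pp] := Pinf (maxn k q0); rewrite gtn_max => /andP[kp q0p]; exists p => r Pr pr.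
  have [Pq pq _ ->] := path_parent Pp Pr pr; set q := parent R r in Pq pq * => E.
  have q0q : q0 < q by apply: leq_trans q0p pq.
  have [|_ /(_ q0 q0q)] := @entry_halts q; first by rewrite E (leq_trans kp).
  by rewrite E Hq0 => H; have := H (Plin Pq0 Pq (ltnW q0q)).
have [p Pp kp] := Pinf k; exists p => r Pr pr.
have [Pq pq _ ->] := path_parent Pp Pr pr => E; apply: no; exists (parent R r) => //.
by have [|] := @entry_halts (parent R r); rewrite E ?(leq_trans kp).
Qed.

Lemma priority_unbounded k : exists m, forall r, P r -> m < r -> k <= pri r.
Proof.
elim: k => [|k [m IH]]; first by exists 0.
have [m' H] := priority_neq k; exists (maxn m m') => r Pr; rewrite gtn_max => /andP[mr m'r].
by rewrite ltn_neqAle IH // andbT eq_sym; apply/eqP/H.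
Qed.

Local Notation P' := (refine_path R (entry R) P).

(** If [e] were first seen at a path stage [q] with [s <= q], the next path stage would have
    priority at most [e], undercutting [s]. *)
Lemma refine_path_jump e s : P' s -> e < pri s ->
  jump P e <-> has (fun q => R q s && halts_at R e q) (iota 0 s).
Proof.
move=> [Ps Hs] es; split; last first.
  by case/hasP => q _ /andP[/Pdown/(_ Ps) Pq]; apply: halts_at_jump.
move=> Je; have ex : exists q, `[< P q >] && halts_at R e q.
  by have [q Pq Hq] := jump_halts_at Je; exists q; rewrite Hq andbT; apply/asboolP.
have [q /andP[/asboolP Pq Hq] minq] := ex_minnP ex.
have qs : q < s.
  rewrite ltnNge; apply/negP => sq.
  have ex' : exists r, `[< P r >] && (q < r).
    by have [r Pr qr] := Pinf q; exists r; rewrite qr andbT; apply/asboolP.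
  have [r /andP[/asboolP Pr qr] minr] := ex_minnP ex'.
  have [Pp qp pr Er] := path_parent Pq Pr qr.
  (* [r] is the path stage immediately after [q], so its priority is the entry at [q]. *)
  have Ep : parent R r = q.
    apply/eqP; rewrite eqn_leq qp andbT leqNgt; apply/negP => qp'.
    have := minr (parent R r); rewrite qp' leqNgt pr andbT => H.
    by have : `[< P (parent R r) >] by [apply/asboolP]; move/H.
  have := Hs r Pr (leq_trans sq (ltnW qr)); rewrite leqNgt; case/negP.
  apply: leq_ltn_trans es; rewrite Er Ep; apply: entry_le => // t tq Rtq.
  apply/negP => Ht; have := minq t; rewrite Ht leqNgt tq andbT => H.
  by have : `[< P t >] by [apply/asboolP/(Pdown Rtq)]; move/H.
by apply/hasP; exists q; rewrite ?mem_iota // Hq andbT; apply: Plin => //; apply: ltnW.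
Qed.

End JumpFromPath.

(** * Computability of the trees, orders and embeddings *)

Section ComputesTree.
Variables (A : nat -> Prop) (R : rel nat).
Hypothesis HR : computes_fun A (fun p => nat_of_bool (R (nfst p) (nsnd p))).

Lemma computes_rel (T : rel nat) f g :
  computes_fun A (fun p => nat_of_bool (T (nfst p) (nsnd p))) ->
  computes_fun A f -> computes_fun A g -> computes_fun A (fun x => nat_of_bool (T (f x) (g x))).
Proof. exact: (computes2 (F := fun x y => nat_of_bool (T x y))). Qed.

Let HR' f g : computes_fun A f -> computes_fun A g ->
  computes_fun A (fun x => nat_of_bool (R (f x) (g x))) := computes_rel HR.
#[local] Hint Resolve HR' : cpt.

Lemma computes_parent f : computes_fun A f -> computes_fun A (fun x => parent R (f x)).
Proof. by apply: computes_comp; rewrite /parent; cpt. Qed.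

Lemma computes_halts_at f g : computes_fun A f -> computes_fun A g ->
  computes_fun A (fun x => nat_of_bool (halts_at R (f x) (g x))).
Proof.
have H : computes_fun A (fun p => nat_of_bool (halts_at R (nfst p) (nsnd p))).
  by rewrite /halts_at; apply: computes_has; [apply: computes_kleeneT|]; cpt.
exact: (computes_rel (T := halts_at R)).
Qed.

#[local] Hint Resolve computes_parent computes_halts_at : cpt.

Lemma computes_entry f : computes_fun A f -> computes_fun A (fun x => entry R (f x)).
Proof. by apply: computes_comp; rewrite /entry; cpt. Qed.

#[local] Hint Resolve computes_entry : cpt.

Lemma computes_priority f :
  computes_fun A f -> computes_fun A (fun x => priority R (entry R) (f x)).
Proof. by rewrite /priority; cpt. Qed.

#[local] Hint Resolve computes_priority : cpt.

Lemma computes_refine :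
  computes_fun A (fun p => nat_of_bool (refine R (entry R) (nfst p) (nsnd p))).
Proof. by rewrite /refine; cpt. Qed.

Lemma computes_branch : computes_fun A (fun x => CodeSeq.code (branch R x)).
Proof.
have := computes_filter_iota (P := R) HR (computes_succ (computes_id A)) (computes_const A 0).
by apply: computes_ext => x; rewrite cats0.
Qed.

Lemma computes_kb (L : rel nat) (s : nat -> seq nat) :
  computes_fun A (fun p => nat_of_bool (L (nfst p) (nsnd p))) ->
  computes_fun A (fun x => CodeSeq.code (s x)) ->
  computes_fun A (fun p => nat_of_bool (kb L s (nfst p) (nsnd p))).
Proof.
move=> HL Hs; apply: (computes_ext (f := fun p => nat_of_bool (lexle false L
  (CodeSeq.decode (CodeSeq.code (s (nfst p)))) (CodeSeq.decode (CodeSeq.code (s (nsnd p))))))).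
  by move=> p; rewrite !CodeSeq.codeK.
by apply: computes_lexle => //; apply: (computes_comp Hs); cpt.
Qed.

Lemma computes_embed : computes_fun A (fun x => CodeSeq.code (rcons (branch R x) x)).
Proof.
have := computes_filter_iota (P := R) HR (computes_succ (computes_id A))
  (computes_succ (computes_npair (computes_id A) (computes_const A 0))).
by apply: computes_ext => x; rewrite decode_npair cats1.
Qed.

Lemma computes_next_sibling S :
  computes_fun A (fun p => nat_of_bool (S (nfst p) (nsnd p))) ->
  computes_fun A (fun p => nat_of_bool
    (next_sibling_order R (refine R (entry R)) S (nfst p) (nsnd p))).
Proof.
move=> HS; apply: computes_kb.
  by rewrite /by_parent; cpt.
pose Q (q x : nat) := (parent (refine R (entry R)) q == parent (refine R (entry R)) x) && R q x.
have HQ : computes_fun A (fun p => nat_of_bool (Q (nfst p) (nsnd p))).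
  have Hp f : computes_fun A f -> computes_fun A (fun x => parent (refine R (entry R)) (f x)).
    apply: (computes_comp (f := parent (refine R (entry R)))).
    have Hr f' g : computes_fun A f' -> computes_fun A g ->
      computes_fun A (fun x => nat_of_bool (refine R (entry R) (f' x) (g x))).
      exact: computes_rel computes_refine.
    by rewrite /parent; cpt.
  by rewrite /Q; cpt.
have := computes_filter_iota HQ (computes_succ (computes_id A)) (computes_const A 0).
by apply: computes_ext => x; rewrite cats0 /sibling_branch /branch -filter_predI.
Qed.

End ComputesTree.

(** To decide [e], search for a stage of the refined path with priority above [e]; such stages exist
    because priorities tend to infinity along the path, and everything up to [e] that ever halts has
    been seen before them. *)
Lemma refine_path_computes_jump R P : tree_order R -> infinite_path R P ->
  computes_fun emptyset (fun p => nat_of_bool (R (nfst p) (nsnd p))) ->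
  computes_set (refine_path R (entry R) P) (jump P).
Proof.
move=> treeR pathP HR0; set B := refine_path _ _ _; apply/computes_setE.
have lift f : computes_fun emptyset f -> computes_fun B f.
  apply: computes_fun_trans; apply/computes_setE.
  apply: (computes_ext (f := fun=> nat_of_bool false)); last exact: computes_false.
  by move=> x; congr nat_of_bool; apply/esym/asboolP.
have HR := lift _ HR0.
have [h [Hh hP]] : exists h, computes_fun B h /\
    forall e, `[< B (h e) >] && (e < priority R (entry R) (h e)).
  apply: (computes_search (P := fun s e => `[< B s >] && (e < priority R (entry R) s))).
    apply: computes_andb; first exact: (computes_comp (computes_oracle B) (computes_nfst (computes_id B))).
    apply: computes_leq; first by cpt.
    by apply: (computes_priority HR); cpt.
  move=> e; have [m Hm] := priority_unbounded treeR pathP e.+1.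
  have [Pinf _ _] := refine_path_infinite (entry R) treeR pathP.
  have [s Bs ms] := Pinf m; exists s; rewrite Hm ?andbT //; first exact/asboolP.
  by case: Bs.
have HR' f g : computes_fun B f -> computes_fun B g ->
    computes_fun B (fun x => nat_of_bool (R (f x) (g x))) by exact: computes_rel.
have HD f g : computes_fun B f -> computes_fun B g ->
    computes_fun B (fun x => nat_of_bool (halts_at R (f x) (g x))) by exact: computes_halts_at.
have Hh' f : computes_fun B f -> computes_fun B (fun x => h (f x)) by exact: computes_comp.
apply: (computes_ext (f := fun e => nat_of_bool
  (has (fun q => R q (h e) && halts_at R e q) (iota 0 (h e))))); last by cpt.
move=> e; congr nat_of_bool; have /andP[/asboolP Bh lt] := hP e.
by apply/idP/asboolP => /(refine_path_jump treeR pathP Bh lt).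
Qed.

(** * The tower *)

Definition monotone_map (X Y : LO) (h : nat -> nat) : Prop :=
  (forall x, ldom X x -> ldom Y (h x)) /\
  forall x y, ldom X x -> ldom X y -> llt X x y -> llt Y (h x) (h y).

Definition omega_map (h : nat -> nat) (c : nat) : nat :=
  CodeSeq.code (map h (CodeSeq.decode c)).

Lemma omega_map_monotone X Y h : is_linear_order Y ->
  monotone_map X Y h -> monotone_map (omega_pow X) (omega_pow Y) (omega_map h).
Proof.
move=> [Yrefl _ _ _] [hdom hlt]; rewrite /omega_map; split.
  move=> c /ldom_omega_pow[/allP D L]; apply/ldom_omega_pow; rewrite CodeSeq.codeK; split.
    by apply/allP => _ /mapP[x /D /asboolP Dx ->]; apply/asboolP/hdom.
  move=> i; rewrite size_map => lt; rewrite !(nth_map 0) ?(ltnW lt) //.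
  have D1 : ldom X (nth 0 (CodeSeq.decode c) i).
    by apply/asboolP/D; rewrite mem_nth // ltnW.
  have D2 : ldom X (nth 0 (CodeSeq.decode c) i.+1) by apply/asboolP/D; rewrite mem_nth.
  have [E|n] := eqVneq (nth 0 (CodeSeq.decode c) i.+1) (nth 0 (CodeSeq.decode c) i).
    by rewrite E; apply/Yrefl/hdom.
  have [] // : llt Y (h (nth 0 (CodeSeq.decode c) i.+1)) (h (nth 0 (CodeSeq.decode c) i)).
  by apply: hlt => //; split; [exact: L | exact/eqP].
move=> c d /ldom_omega_pow[/allP Dc _] /ldom_omega_pow[/allP Dd _] [/str_leP/lexleP H n].
have {H n} [[r [u E]]|[p [x [y [u [v [Ec Ed nxy /asboolP Lxy]]]]]]] :
    lexlt true (leb X) (CodeSeq.decode c) (CodeSeq.decode d).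
  by case: H => // E; case: n; apply: (can_inj CodeSeq.decodeK).
- rewrite /llt /= !CodeSeq.codeK E map_cat; split.
    by apply/str_leP/lexleP; right; left; exists (h r), (map h u).
  move/(can_inj CodeSeq.codeK)/(congr1 size); rewrite size_cat size_map /= addnS => /eqP.
  by rewrite -{1}[size _]addn0 -addnS eqn_add2l.
have Dx : ldom X x by apply/asboolP/Dc; rewrite Ec mem_cat inE eqxx orbT.
have Dy : ldom X y by apply/asboolP/Dd; rewrite Ed mem_cat inE eqxx orbT.
have [Lh nh] : llt Y (h x) (h y) by apply: hlt => //; split=> //; apply/eqP.
rewrite /llt /= !CodeSeq.codeK Ec Ed !map_cat; split.
  apply/str_leP/lexleP; right; right.
  exists (map h p), (h x), (h y), (map h u), (map h v).
  by split=> //; [apply/eqP | apply/asboolP].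
by move/(can_inj CodeSeq.codeK)/eqP; rewrite eqseq_cat // eqxx /= => /eqP[].
Qed.

Lemma omega_iter_map_monotone n X Y h : is_linear_order Y -> monotone_map X Y h ->
  monotone_map (omega_iter n X) (omega_iter n Y) (iter n omega_map h).
Proof.
by move=> linY mono; elim: n => // n IH; apply: omega_map_monotone => //; apply: omega_iter_linear.
Qed.

Lemma computes_omega_iter_map A n h : computes_fun A h -> computes_fun A (iter n omega_map h).
Proof. by move=> Hh; elim: n => // n IH; apply: computes_map_decode => //; apply: computes_id. Qed.

Definition LO_of (L : rel nat) : LO := MkLO (fun _ => True) (fun x y => L x y).

Lemma LO_of_linear L : linear_rel L -> is_linear_order (LO_of L).
Proof.
move=> [R N T O]; split=> /= [x _|x y _ _ H1 H2|x y z _ _ _|x y _ _].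
- exact: R.
- by apply: N; rewrite H1 H2.
- exact: T.
- by apply/orP/O.
Qed.

Lemma LO_of_computable L :
  computes_fun emptyset (fun p => nat_of_bool (L (nfst p) (nsnd p))) -> computable_LO (LO_of L).
Proof.
move=> HL; split; apply/computes_setE.
  by apply: (computes_ext (f := fun=> 1)) => [x|]; [rewrite asboolT | exact: computes_const].
by apply: computes_ext HL => p; rewrite /= asboolb.
Qed.

Fixpoint tower_tree (n : nat) : rel nat :=
  if n is m.+1 then refine (tower_tree m) (entry (tower_tree m)) else leq.

Fixpoint tower_sibling (n : nat) : rel nat :=
  if n is m.+1 then next_sibling_order (tower_tree m) (tower_tree m.+1) (tower_sibling m)
  else leq.

Fixpoint tower_path (n : nat) : nat -> Prop :=
  if n is m.+1 then refine_path (tower_tree m) (entry (tower_tree m)) (tower_path m)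
  else fun _ => True.

Definition tower (n : nat) : rel nat := tree_kb (tower_tree n) (tower_sibling n).

Lemma tower_tree_order n : tree_order (tower_tree n).
Proof. by elim: n => [|n IH]; [exact: leq_tree | exact: refine_tree]. Qed.

Lemma tower_sibling_linear n : linear_rel (tower_sibling n).
Proof.
elim: n => [|n IH]; last exact: (next_sibling_linear _ (tower_tree_order n)).
by split; [exact: leqnn | exact: anti_leq | exact: leq_trans | exact: leq_total].
Qed.

Lemma tower_linear n : linear_rel (tower n).
Proof.
apply: kb_linear; first exact: tower_sibling_linear.
exact/branch_inj/tower_tree_order.
Qed.

Lemma tower_path_infinite n : infinite_path (tower_tree n) (tower_path n).
Proof.
elim: n => [|n IH]; last by apply: refine_path_infinite => //; apply: tower_tree_order.
by split=> // m; exists m.+1.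
Qed.

Lemma tower_unique_path n : unique_path (tower_tree n) (tower_path n).
Proof.
elim: n => [|n IH] //; apply: unique_path_refine => //; first exact: tower_tree_order.
exact: tower_path_infinite.
Qed.

Lemma tower_sibling_wf n : sibling_wf (tower_tree n) (tower_sibling n).
Proof.
elim: n => [|n IH]; first by move=> g _; apply: no_strictly_desc_leq.
apply: (sibling_wf_next (tower_tree_order n) (tower_path_infinite n)
  (tower_sibling_linear n) IH); exact: tower_unique_path.
Qed.

Lemma tower_descent n g s : strictly_desc (tower n) g -> tower_path n s ->
  exists i, forall j, i <= j -> tower_tree n s (g j).
Proof.
apply: tree_kb_descent; [exact: tower_tree_order | exact: tower_path_infinite |
  exact: tower_sibling_linear | exact: tower_sibling_wf | exact: tower_unique_path].
Qed.

Lemma computes_tower_tree n :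
  computes_fun emptyset (fun p => nat_of_bool (tower_tree n (nfst p) (nsnd p))).
Proof. by elim: n => [|n IH]; [rewrite /tower_tree; cpt | exact: computes_refine]. Qed.

Lemma computes_tower_sibling n :
  computes_fun emptyset (fun p => nat_of_bool (tower_sibling n (nfst p) (nsnd p))).
Proof.
elim: n => [|n IH]; first by rewrite /tower_sibling; cpt.
by apply: computes_next_sibling => //; apply: computes_tower_tree.
Qed.

Lemma computes_tower n :
  computes_fun emptyset (fun p => nat_of_bool (tower n (nfst p) (nsnd p))).
Proof.
apply: computes_kb; first exact: computes_tower_sibling.
exact/computes_branch/computes_tower_tree.
Qed.

Definition tower_embed (n x : nat) : nat := CodeSeq.code (rcons (branch (tower_tree n) x) x).

Lemma tower_embed_monotone n :
  monotone_map (LO_of (tower n)) (omega_pow (LO_of (tower n.+1))) (tower_embed n).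
Proof.
have treeR := tower_tree_order n.
have lebE : leb (LO_of (tower n.+1)) = tower n.+1.
  by apply/funext => x; apply/funext => y; rewrite /leb /= asboolb.
split=> [x _|x y _ _ [le /eqP n_xy]]; rewrite /tower_embed.
  apply/ldom_omega_pow; rewrite CodeSeq.codeK; split.
    by apply/allP => q _; apply/asboolP.
  by move=> i; apply: tree_kb_embed_noninc.
have /andP[L nE] := tree_kb_embed (entry (tower_tree n)) treeR le n_xy.
split; last by move/(can_inj CodeSeq.codeK) => E; rewrite E eqxx in nE.
by apply/str_leP; rewrite !CodeSeq.codeK lebE.
Qed.

(** The value reached at level m lies under m exponentials of X_m, so the embedding of X_m is lifted
    through m of them. *)
Fixpoint tower_map (n x : nat) : nat :=
  if n is m.+1 then iter m omega_map (tower_embed m) (tower_map m x) else x.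

Lemma tower_map_monotone n :
  monotone_map (LO_of (tower 0)) (omega_iter n (LO_of (tower n))) (tower_map n).
Proof.
elim: n => [|n [IHd IHlt]]; first by [].
have linY : is_linear_order (omega_pow (LO_of (tower n.+1))).
  exact/omega_pow_linear/LO_of_linear/tower_linear.
have [Hd Hlt] := omega_iter_map_monotone n linY (tower_embed_monotone n).
(* The iterate is regrouped with the new exponential innermost, next to X_{n+1}. *)
rewrite /omega_iter iterSr -/(omega_iter n _); split=> [x /IHd|x y Dx Dy lt]; first exact: Hd.
by apply: Hlt; [exact: IHd | exact: IHd | exact: IHlt].
Qed.

Lemma computes_tower_map n : computes_fun emptyset (tower_map n).
Proof.
elim: n => [|n IH]; first exact: computes_id.
apply: (computes_comp _ IH); apply: computes_omega_iter_map.
exact/computes_embed/computes_tower_tree.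
Qed.

Lemma tower_map_descending n : descending (omega_iter n (LO_of (tower n))) (tower_map n).
Proof.
move=> i; have [Hd Hlt] := tower_map_monotone n; split; first exact: Hd.
apply: Hlt => //; split; last by move/esym/n_Sn.
(* At level 0 the branch of [i] is 0, ..., i, so the branch of [i.+1] extends it and is smaller. *)
rewrite /= /tower /tree_kb /kb (branch_cat leq_tree (leqnSn i)).
by rewrite -[X in lexle _ _ _ X]cats0 lexle_cat; case: filter.
Qed.

Lemma tower_path_computes_jumpn n : computes_set (tower_path n) (jumpn n emptyset).
Proof.
elim: n => [|n IH].
  by exists cZero => x; split=> // _; constructor.
apply: (computes_set_trans _ (jump_mono IH)); apply: refine_path_computes_jump.
- exact: tower_tree_order.
- exact: tower_path_infinite.
- exact: computes_tower_tree.
Qed.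

(** * Reading the path off a descending sequence *)

Lemma computes_graph g : computes_fun (graph g) g.
Proof.
have [h [Hh hP]] : exists h, computes_fun (graph g) h /\ forall x, `[< graph g (npair x (h x)) >].
  apply: (computes_search (P := fun m x => `[< graph g (npair x m) >])).
    by apply: (computes_comp (computes_oracle (graph g))); cpt.
  by move=> x; exists (g x); apply/asboolP; rewrite /graph !npairE.
by apply: computes_ext Hh => x; have /asboolP := hP x; rewrite /graph !npairE.
Qed.

(** A limit lemma: [R s (g j)] is eventually constant in [j]. Whether a given value still occurs
    from [i] on is existential in [g], so the jump can search for an [i] from which only one value
    occurs. *)
Lemma limit_computes (R : rel nat) (P : nat -> Prop) g :
  computes_fun (graph g) (fun p => nat_of_bool (R (nfst p) (nsnd p))) ->
  (forall s, P s -> exists i, forall j, i <= j -> R s (g j)) ->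
  (forall s, ~ P s -> exists i, forall j, i <= j -> ~~ R s (g j)) ->
  computes_set (jump (graph g)) P.
Proof.
move=> HR Hpos Hneg; apply/computes_setE.
have HR' u v : computes_fun (graph g) u -> computes_fun (graph g) v ->
    computes_fun (graph g) (fun x => nat_of_bool (R (u x) (v x))) by exact: computes_rel.
have Hg u : computes_fun (graph g) u -> computes_fun (graph g) (fun x => g (u x)).
  exact: computes_comp (computes_graph g).
pose out p := `[< exists j, (nfst p <= j) && ~~ R (nsnd p) (g j) >].
pose inn p := `[< exists j, (nfst p <= j) && R (nsnd p) (g j) >].
have Hout : computes_fun (jump (graph g)) (fun p => nat_of_bool (out p)).
  by apply: (computes_sigma1 (P := fun j p => (nfst p <= j) && ~~ R (nsnd p) (g j))); cpt.
have Hinn : computes_fun (jump (graph g)) (fun p => nat_of_bool (inn p)).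
  by apply: (computes_sigma1 (P := fun j p => (nfst p <= j) && R (nsnd p) (g j))); cpt.
have Hout' u : computes_fun (jump (graph g)) u ->
    computes_fun (jump (graph g)) (fun x => nat_of_bool (out (u x))).
  exact: (computes_comp (f := fun x => nat_of_bool (out x))).
have Hinn' u : computes_fun (jump (graph g)) u ->
    computes_fun (jump (graph g)) (fun x => nat_of_bool (inn (u x))).
  exact: (computes_comp (f := fun x => nat_of_bool (inn x))).
have [h [Hh hP]] : exists h, computes_fun (jump (graph g)) h /\
    forall s, ~~ out (npair (h s) s) || ~~ inn (npair (h s) s).
  apply: (computes_search (P := fun i s => ~~ out (npair i s) || ~~ inn (npair i s))); first by cpt.
  move=> s; have [/Hpos[i Hi]|/Hneg[i Hi]] := pselect (P s); exists i; apply/orP.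
    left; apply/negP => /asboolP[j]; rewrite !npairE => /andP[ij].
    by rewrite Hi.
  right; apply/negP => /asboolP[j]; rewrite !npairE => /andP[ij].
  by apply/negP/Hi.
apply: (computes_ext (f := fun s => nat_of_bool (~~ out (npair (h s) s)))); last by cpt.
move=> s; congr nat_of_bool; apply/idP/asboolP => [/negP nout|/Hpos[i Hi]].
  apply: contrapT => /Hneg[i Hi]; apply: nout; apply/asboolP; exists (maxn (h s) i).
  by rewrite !npairE leq_maxl Hi // leq_maxr.
case/orP: (hP s) => // /negP; case; apply/asboolP; exists (maxn (h s) i).
by rewrite !npairE leq_maxl Hi // leq_maxr.
Qed.

Lemma tower_descending_computes n g : descending (LO_of (tower n)) g ->
  computes_set (jump (graph g)) (tower_path n).
Proof.
move=> desc; have desc' : strictly_desc (tower n) g.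
  by move=> i; have [_ [/= -> /eqP ->]] := desc i.
have [Pinf Plin Pdown] := tower_path_infinite n.
have [_ Rle _ _ Rlin] := tower_tree_order n.
apply: (limit_computes (R := tower_tree n)) => [|s|s nPs].
- apply: computes_fun_trans (computes_tower_tree n); apply/computes_setE.
  apply: (computes_ext (f := fun=> nat_of_bool false)); last exact: computes_false.
  by move=> x; congr nat_of_bool; apply/esym/asboolP.
- exact: tower_descent.
have [u Pu su] := Pinf s; have [i Hi] := tower_descent desc' Pu; exists i => j ij.
apply/negP => Rs; apply: nPs; apply: Pdown Pu.
exact: Rlin Rs (Hi j ij) (ltnW su).
Qed.

Theorem theorem1p4 (n : nat) :
  (forall X : LO, is_linear_order X -> computable_LO X ->
     (exists f, computable_fun f /\ descending (omega_iter n X) f) ->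
     exists g, descending X g /\ computes_fun (jumpn n emptyset) g)
  /\
  (exists X : LO, [/\ is_linear_order X, computable_LO X,
     (exists f, computable_fun f /\ descending (omega_iter n X) f) &
     forall g, descending X g -> computes_set (jump (graph g)) (jumpn n emptyset)]).
Proof.
split=> [X linX compX [f [Hf desc]]|].
  have [g [Hg dg]] := omega_iter_descent linX (computable_LO_computes compX) Hf desc.
  by exists g.
exists (LO_of (tower n)); split.
- exact/LO_of_linear/tower_linear.
- exact/LO_of_computable/computes_tower.
- by exists (tower_map n); split; [exact: computes_tower_map | exact: tower_map_descending].
move=> g /tower_descending_computes H.
exact: computes_set_trans H (tower_path_computes_jumpn n).
Qed.
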